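(* Let $(\mathcal{X},c)$ be a complete separable metric space. If $c$ is an ultrametric, then \[ r_{c}^{*}(\mathcal{P}(\mathcal{X}))<7.56. \]
   Context: $c$ is an ultrametric if $c(x,y)>0$ for $x\neq y$ and $c(x,z)\le\max\{c(x,y),c(y,z)\}$ for all $x,y,z$ (in addition to symmetry and $c(x,x)=0$). Polish spaces carry their Borel $\sigma$-algebras. A symmetric cost function over a Polish space $\mathcal{X}$ is a function $c:\mathcal{X}^2\to[0,\infty)$ that is measurable with respect to the product $\sigma$-algebra, symmetric, not identically zero, and satisfies $c(x,x)=0$ for all $x$. $\mathcal{P}(\mathcal{X})$ is the set of all probability distributions over $\mathcal{X}$. A coupling of a collection $\{P_\alpha\}_{\alpha\in\mathcal{A}}$ of probability distributions over $\mathcal{X}$ ($\mathcal{A}$ an arbitrary index set) is a family of random variables $X_\alpha:[0,1]\to\mathcal{X}$, all defined on the standard probability space ($[0,1]$, Lebesgue measurable sets, Lebesgue measure), with $X_\alpha\sim P_\alpha$ for every $\alpha$. For $P,Q\in\mathcal{P}(\mathcal{X})$, $C_c^*(P,Q):=\inf\mathbf{E}[c(X,Y)]$ over couplings $(X,Y)$ of $(P,Q)$. The pairwise coupling ratio of a coupling is $r_c(\{X_\alpha\}_{\alpha}):=\inf\{r\ge1:\mathbf{E}[c(X_\alpha,X_\beta)]\le r\,C_c^*(P_\alpha,P_\beta)\ \forall\alpha,\beta\in\mathcal{A}\}$ ($\infty$ if no such $r$ exists), and $r_c^*(\{P_\alpha\}_{\alpha}):=\inf r_c(\{X_\alpha\}_\alpha)$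 over all couplings of $\{P_\alpha\}_\alpha$. A set of probability distributions, such as $\mathcal{P}(\mathcal{X})$, is regarded as a collection indexed by itself. *)

(* Defs.v *)
From HB Require Import structures.
From mathcomp Require Import all_boot all_order all_algebra.
From mathcomp Require Import all_classical all_reals all_analysis.

Set Implicit Arguments.
Unset Strict Implicit.
Unset Printing Implicit Defensive.

Import Order.TTheory GRing.Theory Num.Theory.

Local Open Scope classical_set_scope.
Local Open Scope ring_scope.

(* The distance is [mdist]; completeness refers to the uniformity that [mdist]
   induces.  Points are needed because library measurable types are pointed. *)
#[short(type="completeMetricType")]
HB.structure Definition CompleteMetric (R : realType) :=
  {T of CompletePseudoMetric R T & PseudoMetric_isMetric R T}.

Definition separable (T : topologicalType) : Prop :=
  exists D : set T, countable D /\ dense D.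

Definition ultrametric (R : realType) (X : Type) (c : X -> X -> R) : Prop :=
  [/\ forall x, c x x = 0,
      forall x y, c x y = c y x,
      forall x y, x <> y -> 0 < c x y
    & forall x y z, c x z <= Num.max (c x y) (c y z)].

Notation borel X := (g_sigma_algebraType (@open X)).

(* Lebesgue measure on the Lebesgue measurable subsets of the line, i.e. the
   Caratheodory measurable sets of the outer Lebesgue measure. *)
Notation leb R := (@completed_lebesgue_measure R).

(* Random variables on the standard space [0, 1] are functions on the line of
   which only the restriction to [0, 1] matters. *)
Definition has_law (R : realType) (X : ptopologicalType)
    (Y : R -> X) (P : probability (borel X) R) : Prop :=
  measurable_fun (`[0, 1] : set (caratheodory_type (wlength (@idfun R))^*%mu))
    (Y : _ -> borel X) /\
  forall A : set (borel X), measurable A ->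
    leb R (`[0, 1] `&` Y @^-1` A) = P A.

Definition is_coupling (R : realType) (X : ptopologicalType) (I : Type)
    (P : I -> probability (borel X) R) (Y : I -> R -> X) : Prop :=
  forall i, has_law (Y i) (P i).

Definition expected_cost (R : realType) (X : Type) (c : X -> X -> R)
    (Y Z : R -> X) : \bar R :=
  (\int[leb R]_(w in `[0%R, 1%R]) (c (Y w) (Z w))%:E)%E.

Definition optimal_cost (R : realType) (X : ptopologicalType) (c : X -> X -> R)
    (P Q : probability (borel X) R) : \bar R :=
  ereal_inf [set e | exists Y Z : R -> X,
    [/\ has_law Y P, has_law Z Q & e = expected_cost c Y Z]].

Definition coupling_ratio (R : realType) (X : ptopologicalType)
    (c : X -> X -> R) (I : Type) (P : I -> probability (borel X) R)
    (Y : I -> R -> X) : \bar R :=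
  ereal_inf [set r%:E | r in [set r : R | 1 <= r /\ forall i j,
    (expected_cost c (Y i) (Y j) <= r%:E * optimal_cost c (P i) (P j))%E]].

Definition optimal_ratio (R : realType) (X : ptopologicalType)
    (c : X -> X -> R) (I : Type) (P : I -> probability (borel X) R) : \bar R :=
  ereal_inf [set coupling_ratio c P Y | Y in [set Y | is_coupling P Y]].

(* Main.v *)
Require Import Defs.
From HB Require Import structures.
From mathcomp Require Import all_boot all_order all_algebra.
From mathcomp Require Import all_classical all_reals all_analysis.
From mathcomp Require Import measurable_realfun.
From mathcomp Require Import zify ring lra.

Set Implicit Arguments.
Unset Strict Implicit.
Unset Printing Implicit Defensive.

Import Order.TTheory GRing.Theory Num.Theory.
Import numFieldNormedType.Exports.

(** In an ultrametric space the balls of a given radius form a partition, and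
    a smaller radius gives a finer partition.  Let D(t) be the l1 distance
    between the masses that P and Q give to the balls of radius t, fix s > 1,
    and consider the radii s ^ j for j an integer.

    Lower bound.  Two points in different balls of radius s ^ j are at distance
    at least s ^ j, so that the distance dominates the sum of the increments
    s ^ j - s ^ (j - 1) over the j whose balls separate the points.  In any
    coupling the balls of radius s ^ j separate with probability at least
    D(s ^ j) / 2.  Hence every coupling of P and Q costs at least
      (1 - 1 / s) / 2 * sum_j s ^ j * D(s ^ j)          ([cost_ge]).

    Upper bound.  Fix M, keep one radius out of M, say the s ^ (m + M k), and
    sample P by descending through the tree of balls: in the current ball, pick
    a ball of the next smaller radius with its conditional probability.  All
    the P share the randomness.  Each choice is an exponential race, in which
    letter n has a clock of rate p n that does not otherwise depend on p; the
    letters selected for p and q differ with probability at most the l1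
    distance of p and q ([select_coupling]).  The samples of P and Q then part
    inside a ball B of the level k + 1 with probability at most
      min (P B) (Q B) * (l1 distance of the conditional laws on B);
    as rescaling the larger of P B and Q B costs at most their difference,
    summing over B bounds the probability of parting at that level by
    D(r_k) + D(r_(k + 1)), where r_k = s ^ (m + M k) ([sample_split]).  When
    this happens, the distance is below r_(k + 1).

    Averaging.  Taking m uniformly at random among 0, ..., M - 1, each radius
    is used with probability 1 / M, so that the expected cost is at most
      (1 + s ^ M) / M * sum_j s ^ j * D(s ^ j)          ([mixture_cost]).
    The ratio of the two bounds is 2 (1 + s ^ M) / (M (1 - 1 / s)), which is
    about 7.535 for s = 11 / 10 and M = 13.

    Two points need care.  First, an unbounded space has no largest ball from
    which to start.  One says instead that a ball is selected when, at every
    level above it, the choice made in the ancestor of that level is the next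
    ancestor; the probabilities of these choices telescope to the mass of the
    ball ([located_law]).  Second, all the randomness must come from one
    uniform number.  Reading every other binary digit splits it into two
    independent uniform numbers ([unif_split]), and iterating this yields an
    independent sequence ([iid_stream]). *)

Local Open Scope classical_set_scope.
Local Open Scope ring_scope.

(** * Laws and independence from a generating system *)

(** Dynkin's lemma: as functions of A, both sides are finite measures of the
    same total mass.  For E the whole space this identifies the law of f; when
    Q is the law of f, it says that f is independent of E. *)
Lemma law_indep (R : realType) d d' (T : measurableType d)
    (T' : measurableType d') (P : probability T R) (Q : probability T' R)
    (f : T -> T') (E : set T) (G : set (set T')) :
  @measurable _ T' = <<s G >> -> setI_closed G ->
  measurable_fun setT f -> measurable E ->
  (forall A, G A -> P (f @^-1` A `&` E) = Q A * P E)%E ->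
  forall A, measurable A -> P (f @^-1` A `&` E) = (Q A * P E)%E.
Proof.
move=> GE GI mf mE hG.
have mfA A : measurable A -> measurable (f @^-1` A).
  by move=> mA; rewrite -[X in measurable X]setTI; exact: mf.
move=> A mA.
apply: (@dynkin_induction _ T' G (fun A => P (f @^-1` A `&` E) = Q A * P E)%E) => //.
- by rewrite preimage_setT setTI probability_setT mul1e.
- move=> S mS hS; have -> : f @^-1` (~` S) = ~` (f @^-1` S) by [].
  have -> : P (~` (f @^-1` S) `&` E) = (P E - P (f @^-1` S `&` E))%E.
    rewrite setIC -setDE measureD ?[E `&` _]setIC//; first exact: mfA.
    by rewrite -ge0_fin_numE// fin_num_measure.
  by rewrite hS probability_setC// muleBl ?mul1e// ?fin_num_measure.
- move=> F mF tF hF; rewrite preimage_bigcup setI_bigcupl.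
  have mFE i : measurable (f @^-1` F i `&` E).
    by apply: measurableI => //; exact: mfA.
  have tFE : trivIset setT (fun i => f @^-1` F i `&` E).
    apply/trivIsetP => i j _ _ ij; rewrite setIACA -preimage_setI.
    by move/trivIsetP : tF => -> //; rewrite preimage_set0 set0I.
  rewrite (measure_semi_bigcup _ mFE tFE) ?measure_semi_bigcup//; last 2 first.
  + exact: bigcupT_measurable.
  + exact: bigcupT_measurable.
  have -> : P E = (fine (P E))%:E by rewrite fineK// fin_num_measure.
  rewrite muleC -nneseriesZl//; apply: eq_eseriesr => i _.
  by rewrite [RHS]muleC fineK ?fin_num_measure//; exact: hF.
- by rewrite -GE.
Qed.

Section uniform_law.
Variable R : realType.

(** The interval is half-open so that the cells [m / 4 ^ n, (m + 1) / 4 ^ n[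
    cover it exactly. *)
Definition unif : set (measurableTypeR R) -> \bar R :=
  mrestr lebesgue_measure (measurable_itv `[0%R, 1%R[).

HB.instance Definition _ := Measure.on unif.

Let unif_setT : unif setT = 1%E.
Proof.
by rewrite /unif /mrestr setTI lebesgue_measure_itv/= lte_fin ltr01 sube0.
Qed.

HB.instance Definition _ := Measure_isProbability.Build _ _ _ unif unif_setT.

Lemma unif_itv_co (a b : R) : 0 <= a -> a <= b -> b <= 1 ->
  unif `[a, b[ = (b - a)%:E.
Proof.
move=> a0 ab b1; rewrite /unif /mrestr (_ : _ `&` _ = `[a, b[%classic).
  by rewrite lebesgue_measure_itv/= lte_fin; case: ltgtP ab => // -> _; rewrite subrr.
apply/seteqP; split => x /=; rewrite !in_itv/=; first by case.
move=> /andP[ax xb]; rewrite ax xb (le_trans a0 ax) (lt_le_trans xb b1).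
by [].
Qed.

Lemma unif_lt (t : R) :
  unif `]-oo, t[ = (Num.max 0 (Num.min t 1))%:E.
Proof.
have [t0|t0] := leP t 0.
  rewrite (min_idPl _) ?(le_trans t0)// (max_idPl _)//.
  rewrite /unif /mrestr (_ : _ `&` _ = set0) ?measure0//.
  apply/seteqP; split => x //=; rewrite !in_itv/=.
  by move=> [xt /andP[x0 _]]; lra.
rewrite (max_idPr _) ?le_min ?ltW//.
rewrite /unif /mrestr (_ : _ `&` _ = `[0%R, Num.min t 1%R[%classic).
  rewrite lebesgue_measure_itv/= lte_fin lt_min t0 ltr01/=.
  by rewrite sube0.
apply/seteqP; split => x /=; rewrite !in_itv/= lt_min.
  by move=> [-> /andP[-> ->]].
by move=> /andP[-> /andP[-> ->]].
Qed.

Lemma unif_indep d (T : measurableType d) (P : probability T R)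
    (f : T -> measurableTypeR R) (E : set T) :
  measurable_fun setT f -> measurable E ->
  (forall t, P (f @^-1` `]-oo, t[ `&` E) = unif `]-oo, t[ * P E)%E ->
  forall A, measurable A -> P (f @^-1` A `&` E) = (unif A * P E)%E.
Proof.
move=> mf mE ht.
have GI : setI_closed (@RGenInftyO.G R).
  move=> _ _ [x ->] [y ->]; exists (Num.min x y).
  by apply/seteqP; split => z /=; rewrite !in_itv/= lt_min => /andP.
have := @law_indep R _ _ T (measurableTypeR R) P unif f E (@RGenInftyO.G R)
  (RGenInftyO.measurableE R) GI mf mE.
by apply=> _ [x ->]; exact: ht.
Qed.

End uniform_law.

(** * Splitting a uniform number into two independent ones *)

(** The bits of weight 2 in the n lowest base 4 digits of m; the bits of
    weight 1 are read by [odd_bits]. *)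
Fixpoint even_bits (n m : nat) : nat :=
  if n is k.+1 then (2 * even_bits k (m %/ 4) + (m %/ 2) %% 2)%N else 0%N.

Fixpoint odd_bits (n m : nat) : nat :=
  if n is k.+1 then (2 * odd_bits k (m %/ 4) + m %% 2)%N else 0%N.

Fixpoint interleave (n i j : nat) : nat :=
  if n is k.+1 then
    (4 * interleave k (i %/ 2) (j %/ 2) + 2 * (i %% 2) + j %% 2)%N
  else 0%N.

Lemma even_bits_lt n m : (even_bits n m < 2 ^ n)%N.
Proof.
elim: n m => //= n IH m; rewrite expnS; have := IH (m %/ 4)%N.
lia.
Qed.

Lemma odd_bits_lt n m : (odd_bits n m < 2 ^ n)%N.
Proof.
elim: n m => //= n IH m; rewrite expnS; have := IH (m %/ 4)%N.
lia.
Qed.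

Lemma interleave_lt n i j : (interleave n i j < 4 ^ n)%N.
Proof.
elim: n i j => //= n IH i j; rewrite expnS.
have := IH (i %/ 2)%N (j %/ 2)%N; lia.
Qed.

Lemma interleaveP n i j m : (i < 2 ^ n)%N -> (j < 2 ^ n)%N -> (m < 4 ^ n)%N ->
  even_bits n m = i /\ odd_bits n m = j <-> m = interleave n i j.
Proof.
elim: n i j m => [|n IH] i j m; first by rewrite !expn0 /=; lia.
rewrite !expnS => hi hj hm /=.
have [] := IH (i %/ 2)%N (j %/ 2)%N (m %/ 4)%N; [lia|lia|lia|].
move=> H1 H2; split.
  move=> [Hi Hj]; have : (m %/ 4)%N = interleave n (i %/ 2) (j %/ 2).
    by apply: H1; lia.
  lia.
move=> Hm; have := H2; lia.
Qed.

Section halves.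
Variable R : realType.

Definition quaternary (n : nat) (x : R) : nat := Num.truncn (4%:R ^+ n * x).

Lemma quaternaryS n x : quaternary n x = (quaternary n.+1 x %/ 4)%N.
Proof.
rewrite /quaternary exprS -mulrA; set y := _ ^+ n * x.
have [y0|y0] := leP 0 y; last first.
  rewrite !(truncn0Pn _ _)// -ltNge; lra.
apply: truncn_def; have := truncn_itv (mulr_ge0 (ler0n R 4) y0).
set m := Num.truncn _; move=> /andP[h1 h2].
have e : m = (m %/ 4 * 4 + m %% 4)%N by exact: divn_eq.
have l : (m %% 4 <= 3)%N by rewrite -ltnS ltn_pmod.
move: h1 h2; rewrite -(ler_nat R) in l; rewrite -natr1 {1 2}e !natrD natrM -natr1.
have : 0 <= (m %% 4)%:R :> R by [].
lra.
Qed.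

Lemma measurable_truncn_scale (a : R) : 0 < a ->
  measurable_fun setT (fun x : measurableTypeR R => Num.truncn (a * x) : nat).
Proof.
move=> a0 mD; apply: (measurability _ NGenCInfty.measurableE) => //.
move=> _ [_ [k ->] <-].
rewrite setTI; case: k => [|k].
  by rewrite (_ : _ @^-1` _ = setT)//; apply/seteqP; split.
rewrite (_ : _ @^-1` _ = `[k.+1%:R / a, +oo[%classic)//.
apply/seteqP; split => x /=; rewrite !in_itv/= !andbT ler_pdivrMr//.
  by rewrite leEnat truncn_gt_nat mulrC.
by rewrite leEnat truncn_gt_nat mulrC.
Qed.

Lemma measurable_quaternary n :
  measurable_fun setT (quaternary n : measurableTypeR R -> nat).
Proof. by apply: measurable_truncn_scale; rewrite exprn_gt0. Qed.

Lemma unif_quaternary n m : (m < 4 ^ n)%N ->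
  unif [set x : R | quaternary n x = m] = (4%:R ^- n)%:E.
Proof.
move=> mn; have n0 : 0 < 4%:R ^+ n :> R by rewrite exprn_gt0.
transitivity (unif `[m%:R / 4%:R ^+ n, m.+1%:R / 4%:R ^+ n[%classic : \bar R).
  rewrite /unif /mrestr; congr (lebesgue_measure _); apply/seteqP; split => x.
    move=> [<-{mn} x01]; split=> //; move: x01; rewrite /= !in_itv/= => /andP[x0 _].
    rewrite ler_pdivrMr// ltr_pdivlMr// ![x * _]mulrC.
    by apply: truncn_itv; rewrite mulr_ge0// ltW.
  move=> [xm x01]; split=> //; move: xm; rewrite /= in_itv/=.
  by rewrite ler_pdivrMr// ltr_pdivlMr// ![x * _]mulrC => /truncn_def.
rewrite unif_itv_co.
- by rewrite -mulrBl -natr1 [_ + 1]addrC addrK mul1r.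
- by rewrite divr_ge0// ltW.
- by rewrite ler_pM2r ?invr_gt0// ler_nat.
- by rewrite ler_pdivrMr// mul1r -natrX ler_nat.
Qed.

(** The number whose binary expansion has the prefixes f n (quaternary n x),
    provided that each prefix extends the previous one by one digit. *)
Definition dyadic (f : nat -> nat -> nat) (x : R) : R :=
  sup (range (fun n => (f n (quaternary n x))%:R / 2%:R ^+ n)).

Section dyadic.
Variable f : nat -> nat -> nat.
Hypothesis f_lt : forall n m, (f n m < 2 ^ n)%N.
Hypothesis fS : forall n m,
  (2 * f n (m %/ 4) <= f n.+1 m <= 2 * f n (m %/ 4) + 1)%N.

Let h n (x : R) : R := (f n (quaternary n x))%:R / 2%:R ^+ n.

Let pow2 n : 0 < 2%:R ^+ n :> R. Proof. by rewrite exprn_gt0. Qed.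

Let h_bounds n k x :
  h n x <= h (n + k) x
    <= (f n (quaternary n x)).+1%:R / 2%:R ^+ n - 2%:R ^- (n + k).
Proof.
elim: k => [|k /andP[IH1 IH2]].
  rewrite addn0 lexx /= -natr1 mulrDl mul1r addrK; exact: lexx.
rewrite addnS; have /andP[] := fS (n + k) (quaternary (n + k).+1 x).
rewrite -quaternaryS; set b := f (n + k)%N _; set a := f _ _.
rewrite -!(ler_nat R) natrD natrM => h1 h2.
have hE : h (n + k) x = b%:R / 2%:R ^+ (n + k) by [].
have -> : h (n + k).+1 x = a%:R / 2%:R / 2%:R ^+ (n + k).
  by rewrite /h -/a exprS invfM mulrA.
have e : b%:R <= a%:R / 2%:R :> R by lra.
have e' : a%:R / 2%:R <= b%:R + 1 / 2%:R :> R by lra.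
have i0 : 0 < 2%:R ^- (n + k) :> R by rewrite invr_gt0.
have m1 := ler_wpM2r (ltW i0) e; have m2 := ler_wpM2r (ltW i0) e'.
rewrite exprS invfM.
apply/andP; split; first by rewrite (le_trans IH1)// hE.
move: IH2 m1 m2; rewrite hE mulrDl mul1r; lra.
Qed.

Let h_nd x : nondecreasing_seq (h ^~ x).
Proof.
by apply/nondecreasing_seqP => n; have /andP[] := h_bounds n 1 x; rewrite addn1.
Qed.

Let h_ub x : has_ubound (range (h ^~ x)).
Proof.
exists 1 => _ [n _ <-]; rewrite /h ler_pdivrMr// mul1r -natrX ler_nat.
exact/ltnW/f_lt.
Qed.

(** Prefixes increase, whereas prefixes plus one unit in the last place
    decrease. *)
Lemma dyadic_bounds n x :
  (f n (quaternary n x))%:R / 2%:R ^+ n <= dyadic f x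
    <= (f n (quaternary n x)).+1%:R / 2%:R ^+ n.
Proof.
apply/andP; split.
  by apply: ub_le_sup; [exact: h_ub|exists n].
apply: ge_sup; first by exists (h 0 x), 0%N.
move=> _ [m _ <-]; apply: (@le_trans _ _ (h (n + m) x)).
  by apply: (h_nd x); exact: leq_addl.
have /andP[_ /le_trans] := h_bounds n m x; apply.
by rewrite gerBl invr_ge0 ltW.
Qed.

Lemma measurable_dyadic :
  measurable_fun setT (dyadic f : measurableTypeR R -> measurableTypeR R).
Proof.
apply: (@measurable_fun_cvg _ _ _ _ (h : nat -> measurableTypeR R -> R))
  => [m|x _]; last first.
  exact: nondecreasing_cvgn.
have mg : measurable_fun setT (fun k : nat => (f m k)%:R / 2%:R ^+ m : R).
  by move=> _ Y _; exact: Logic.I.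
exact: (measurableT_comp mg (measurable_quaternary m)).
Qed.

Lemma dyadic_ge0 x : 0 <= dyadic f x.
Proof.
by have /andP[+ _] := dyadic_bounds 0 x; apply: le_trans; rewrite divr_ge0.
Qed.

Lemma dyadic_le1 x : dyadic f x <= 1.
Proof.
apply: ge_sup; first by exists (h 0 x), 0%N.
move=> _ [n _ <-]; rewrite ler_pdivrMr// mul1r -natrX ler_nat.
exact/ltnW/f_lt.
Qed.

End dyadic.


Let ev n (x : R) := even_bits n (quaternary n x).
Let od n (x : R) := odd_bits n (quaternary n x).

Lemma measurable_digits (f : nat -> nat -> nat) n Y :
  measurable [set x : measurableTypeR R | Y (f n (quaternary n x))].
Proof.
rewrite -[X in measurable X]setTI.
exact: (@measurable_quaternary n measurableT (f n @^-1` Y)).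
Qed.

(** Interleaving digits matches the 4 ^ n cells of the unit interval with
    those of the unit square. *)
Lemma unif_grid n I J : (I <= 2 ^ n)%N -> (J <= 2 ^ n)%N ->
  unif [set x | (ev n x < I)%N /\ (od n x < J)%N]
  = (I%:R / 2%:R ^+ n * (J%:R / 2%:R ^+ n))%:E.
Proof.
have mcell Y Z : measurable ([set x : measurableTypeR R | Y (ev n x) /\ Z (od n x)]).
  by apply: measurableI; exact: measurable_digits.
have cell i j : (i < 2 ^ n)%N -> (j < 2 ^ n)%N ->
    unif [set x | ev n x = i /\ od n x = j] = (4%:R ^- n)%:E.
  move=> hi hj; rewrite -(unif_quaternary (interleave_lt n i j)).
  rewrite /unif /mrestr; congr (lebesgue_measure _).
  apply/seteqP; split => x [h x01]; split => //.
    apply/(interleaveP hi hj) => //.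
    move: x01; rewrite /= in_itv/= => /andP[x0 x1].
    rewrite truncn_lt_nat ?mulr_ge0// natrX.
    by rewrite -[ltRHS]mulr1 ltr_pM2l// exprn_gt0.
  by apply/(interleaveP hi hj) => //; rewrite h interleave_lt.
have row i K : (i < 2 ^ n)%N -> (K <= 2 ^ n)%N ->
    unif [set x | ev n x = i /\ (od n x < K)%N] = (K%:R / 4%:R ^+ n)%:E.
  move=> hi; elim: K => [_|K IH hK].
    by rewrite mul0r (_ : [set x | _] = set0) ?measure0// -subset0 => x [].
  rewrite (_ : [set x | _] = [set x | ev n x = i /\ (od n x < K)%N] `|`
                             [set x | ev n x = i /\ od n x = K]).
    rewrite measureU//=.
    - rewrite IH ?cell//; last exact: ltnW.
      by rewrite -EFinD -[K.+1%:R]natr1 mulrDl mul1r.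
    - exact: (mcell (eq^~ i) (fun k => is_true (k < K)%N)).
    - exact: (mcell (eq^~ i) (eq^~ K)).
    - by rewrite -subset0 => x /= [[_ h1] [_ h2]]; lia.
  apply/seteqP; split => x /=; first by move=> [? ?]; lia.
  by lia.
elim: I => [_ _|I IH hI hJ].
  by rewrite !mul0r (_ : [set x | _] = set0) ?measure0// -subset0 => x [].
rewrite (_ : [set x | _] = [set x | (ev n x < I)%N /\ (od n x < J)%N] `|`
                           [set x | ev n x = I /\ (od n x < J)%N]).
  rewrite measureU//=.
  - rewrite IH ?row//; last exact: ltnW.
    rewrite -EFinD; congr EFin.
    have -> : 4%:R = 2%:R * 2%:R :> R by rewrite -natrM.
    by rewrite exprMn invfM -[I.+1%:R]natr1; ring.
  - exact: (mcell (fun k => is_true (k < I)%N) (fun k => is_true (k < J)%N)).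
  - exact: (mcell (eq^~ I) (fun k => is_true (k < J)%N)).
  - by rewrite -subset0 => x /= [[h1 _] [h2 _]]; lia.
by apply/seteqP; split => x /=; lia.
Qed.

End halves.

Section split.
Variable R : realType.

Lemma even_bitsS n m :
  (2 * even_bits n (m %/ 4) <= even_bits n.+1 m <= 2 * even_bits n (m %/ 4) + 1)%N.
Proof. by rewrite /=; lia. Qed.

Lemma odd_bitsS n m :
  (2 * odd_bits n (m %/ 4) <= odd_bits n.+1 m <= 2 * odd_bits n (m %/ 4) + 1)%N.
Proof. by rewrite /=; lia. Qed.

Definition fst_half : measurableTypeR R -> measurableTypeR R := dyadic even_bits.
Definition snd_half : measurableTypeR R -> measurableTypeR R := dyadic odd_bits.

Lemma measurable_fst_half : measurable_fun setT fst_half.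
Proof. exact: (measurable_dyadic even_bits_lt even_bitsS). Qed.

Lemma measurable_snd_half : measurable_fun setT snd_half.
Proof. exact: (measurable_dyadic odd_bits_lt odd_bitsS). Qed.

Let measurable_quadrant (s t : R) :
  measurable (fst_half @^-1` `]-oo, s[ `&` snd_half @^-1` `]-oo, t[).
Proof.
apply: measurableI; rewrite -[X in measurable X]setTI.
  by apply: measurable_fst_half => //; exact: measurable_itv.
by apply: measurable_snd_half => //; exact: measurable_itv.
Qed.

Let trunc_bounds n (r : R) : 0 <= r -> let s := Num.min r 1 in
  let I := Num.truncn (s * 2%:R ^+ n) in let I' := minn I.+1 (2 ^ n) in
  [/\ (I.-1 <= 2 ^ n)%N,
    forall a, (a < I.-1)%N -> a.+1%:R / 2%:R ^+ n < r,
    forall a : nat, (a < 2 ^ n)%N -> a%:R / 2%:R ^+ n < r -> (a < I')%N,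
    s - 2%:R / 2%:R ^+ n <= I.-1%:R / 2%:R ^+ n <= s
  & s <= I'%:R / 2%:R ^+ n <= s + 1 / 2%:R ^+ n ].
Proof.
move=> r0 s I I'.
have s0 : 0 <= s by rewrite le_min r0 ler01.
have s1 : s <= 1 by rewrite ge_min lexx orbT.
have sr : s <= r by rewrite ge_min lexx.
have n0 : 0 < 2%:R ^+ n :> R by rewrite exprn_gt0.
have n_neq0 : 2%:R ^+ n != 0 :> R by rewrite gt_eqF.
have /andP[h1 h2] := truncn_itv (mulr_ge0 s0 (ltW n0)).
rewrite -/I in h1 h2.
have hI : (I <= 2 ^ n)%N.
  rewrite -(ler_nat R) natrX (le_trans h1)// -[leRHS]mul1r.
  by rewrite ler_pM2r.
split; first by rewrite (leq_trans (leq_pred _)).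
- move=> a aI; apply: lt_le_trans sr.
  by rewrite ltr_pdivrMr// (lt_le_trans _ h1)// ltr_nat; lia.
- move=> a an ar; rewrite leq_min an andbT -(ltr_nat R) (le_lt_trans _ h2)//.
  rewrite -ler_pdivrMr// le_min ltW//= ler_pdivrMr// mul1r -natrX ler_nat.
  exact: ltnW.
- apply/andP; split; last first.
    by rewrite ler_pdivrMr// (le_trans _ h1)// ler_nat leq_pred.
  rewrite ler_pdivlMr// mulrBl divfK//.
  have : I.+1%:R <= I.-1%:R + 2 :> R by rewrite -natrD ler_nat; lia.
  by move: h2; lra.
- apply/andP; split.
    rewrite ler_pdivlMr//; rewrite /I'; case: leqP => _; first exact: ltW.
    by rewrite natrX -[leRHS]mul1r ler_pM2r.
  rewrite ler_pdivrMr// mulrDl divfK//.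
  apply: (@le_trans _ _ I.+1%:R); first by rewrite ler_nat geq_minl.
  by rewrite -natr1 lerD2r.
Qed.

(** Rectangles of the grid approximate the quadrant from inside and from
    outside, up to 4 / 2 ^ n.  Only inequalities between prefixes are used, so
    that numbers with two binary expansions need no special treatment. *)
Let unif_quadrant_ge0 (r r' : R) : 0 <= r -> 0 <= r' ->
  unif (fst_half @^-1` `]-oo, r[ `&` snd_half @^-1` `]-oo, r'[)
  = (Num.min r 1 * Num.min r' 1)%:E.
Proof.
move=> hs ht; set s := Num.min r 1; set t := Num.min r' 1.
set E := _ `&` _.
have mE : measurable E by exact: measurable_quadrant.
have [u uE] : exists u : R, unif E = u%:E.
  by exists (fine (unif E)); rewrite fineK// fin_num_measure.
rewrite uE; congr EFin.
have close n : `|u - s * t| <= 4%:R / 2%:R ^+ n.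
  have n0 : 0 < 2%:R ^+ n :> R by rewrite exprn_gt0.
  have := trunc_bounds n hs; rewrite /= -/s => -[hI aI bI hI1 hI2].
  have := trunc_bounds n ht; rewrite /= -/t => -[hJ aJ bJ hJ1 hJ2].
  set I := Num.truncn (s * _) in hI aI bI hI1 hI2.
  set J := Num.truncn (t * _) in hJ aJ bJ hJ1 hJ2.
  have mdig Y Z : measurable [set x : measurableTypeR R |
      Y (even_bits n (quaternary n x)) /\ Z (odd_bits n (quaternary n x))].
    by apply: measurableI; exact: measurable_digits.
  have lo : (I.-1%:R / 2%:R ^+ n * (J.-1%:R / 2%:R ^+ n) <= u).
    rewrite -lee_fin -unif_grid// -uE; apply: le_measure; rewrite ?inE//.
      exact: (mdig (fun k => is_true (k < _)%N) (fun k => is_true (k < _)%N)).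
    move=> x [h1 h2]; split; rewrite /= in_itv/=.
      have /andP[_ b] := dyadic_bounds even_bits_lt even_bitsS n x.
      exact/(le_lt_trans b)/aI.
    have /andP[_ b] := dyadic_bounds odd_bits_lt odd_bitsS n x.
    exact/(le_lt_trans b)/aJ.
  have up : u <= (minn I.+1 (2 ^ n))%:R / 2%:R ^+ n
               * ((minn J.+1 (2 ^ n))%:R / 2%:R ^+ n).
    rewrite -lee_fin -unif_grid ?geq_minr// -uE; apply: le_measure; rewrite ?inE//.
      exact: (mdig (fun k => is_true (k < _)%N) (fun k => is_true (k < _)%N)).
    move=> x []; rewrite /= !in_itv/= => h1 h2.
    split.
      have /andP[b _] := dyadic_bounds even_bits_lt even_bitsS n x.
      exact/(bI _ (even_bits_lt _ _))/(le_lt_trans b).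
    have /andP[b _] := dyadic_bounds odd_bits_lt odd_bitsS n x.
    exact/(bJ _ (odd_bits_lt _ _))/(le_lt_trans b).
  move: hI1 hI2 hJ1 hJ2 lo up.
  set a := _.-1%:R / _; set b := (minn _ _)%:R / _.
  set c := J.-1%:R / _; set d := (minn J.+1 _)%:R / _.
  set e := (X in _ / X); have e0 : 0 < e^-1 by rewrite invr_gt0.
  set q := e^-1 in e0 *.
  have a0 : 0 <= a by rewrite divr_ge0// ltW.
  have c0 : 0 <= c by rewrite divr_ge0// ltW.
  have b1 : b <= 1 by rewrite ler_pdivrMr// mul1r -natrX ler_nat geq_minr.
  have d1 : d <= 1 by rewrite ler_pdivrMr// mul1r -natrX ler_nat geq_minr.
  move=> /andP[? ?] /andP[? ?] /andP[? ?] /andP[? ?] lo up.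
  have ? : 0 <= s by rewrite le_min hs ler01.
  have ? : 0 <= t by rewrite le_min ht ler01.
  have ? : s <= 1 by rewrite ge_min lexx orbT.
  have ? : t <= 1 by rewrite ge_min lexx orbT.
  rewrite ler_norml; apply/andP; split; nra.
apply/eqP; rewrite -subr_eq0 -normr_le0; apply/ler_addgt0Pr => e e0.
rewrite add0r; apply: (le_trans (close (Num.truncn (4%:R / e)).+1)).
set k := (Num.truncn _).+1; rewrite ler_pdivrMr ?exprn_gt0//.
rewrite -ler_pdivrMl// mulrC; apply: (@le_trans _ _ k%:R).
  exact/ltW/truncnS_gt.
by rewrite -natrX ler_nat ltnW// ltn_expl.
Qed.

Lemma unif_quadrant (s t : R) :
  unif (fst_half @^-1` `]-oo, s[ `&` snd_half @^-1` `]-oo, t[)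
  = (unif `]-oo, s[ * unif `]-oo, t[)%E.
Proof.
have neg (f : measurableTypeR R -> R) r : (forall x, 0 <= f x) -> r < 0 ->
    f @^-1` `]-oo, r[ = set0.
  move=> f0 r0; apply/seteqP; split => x //=; rewrite in_itv/=.
  by move=> fr; have := lt_trans (le_lt_trans (f0 x) fr) r0; rewrite ltxx.
rewrite !unif_lt -EFinM.
have [s0|s0] := ltP s 0.
  rewrite (neg fst_half)//; last by move=> x; exact: dyadic_ge0 even_bits_lt even_bitsS x.
  rewrite set0I measure0 (max_idPl _) ?mul0r//.
  by rewrite ge_min ltW.
have [t0|t0] := ltP t 0.
  rewrite (neg snd_half)//; last by move=> x; exact: dyadic_ge0 odd_bits_lt odd_bitsS x.
  rewrite setI0 measure0 [X in _ * X](max_idPl _) ?mulr0//.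
  by rewrite ge_min ltW.
rewrite unif_quadrant_ge0// !(max_idPr _)//; by rewrite le_min ler01 andbT.
Qed.

(** The two numbers read off a uniform number are uniform and independent.
    This passes from quadrants to products of Borel sets one factor at a time. *)
Lemma unif_split A B : measurable A -> measurable B ->
  unif (fst_half @^-1` A `&` snd_half @^-1` B) = (unif A * unif B)%E.
Proof.
move=> mA mB.
have mf C : measurable C -> measurable (fst_half @^-1` C).
  by move=> mC; rewrite -[X in measurable X]setTI; exact: measurable_fst_half.
have ms C : measurable C -> measurable (snd_half @^-1` C).
  by move=> mC; rewrite -[X in measurable X]setTI; exact: measurable_snd_half.
have law_fst C : measurable C -> unif (fst_half @^-1` C) = unif C.
  move=> mC; have := @unif_indep R _ _ (@unif R) fst_half setT measurable_fst_half measurableT.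
  rewrite probability_setT; move=> /(_ _ C mC); rewrite setIT mule1; apply => t.
  rewrite setIT mule1.
  have := unif_quadrant t 2%:R; rewrite [X in (_ * X)%E](_ : _ = 1%E) ?mule1.
    move=> <-; congr unif; apply/seteqP; split => [x xt|x []//]; split => //.
    rewrite /= in_itv/=; apply: (@le_lt_trans _ _ 1); last by rewrite ltr1n.
    exact: dyadic_le1 odd_bits_lt x.
  rewrite unif_lt (min_idPr _) ?ler1n// (max_idPr _)//.
have law_snd : unif (snd_half @^-1` B) = unif B.
  have := @unif_indep R _ _ (@unif R) snd_half setT measurable_snd_half measurableT.
  rewrite probability_setT; move=> /(_ _ B mB); rewrite setIT mule1; apply => t.
  rewrite setIT mule1.
  have := unif_quadrant 2%:R t; rewrite [X in (X * _)%E](_ : _ = 1%E) ?mul1e.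
    move=> <-; congr unif; apply/seteqP; split => [x xt|x []//]; split => //.
    rewrite /= in_itv/=; apply: (@le_lt_trans _ _ 1); last by rewrite ltr1n.
    exact: dyadic_le1 even_bits_lt x.
  rewrite unif_lt (min_idPr _) ?ler1n// (max_idPr _)//.
have half_line t : unif (snd_half @^-1` B `&` fst_half @^-1` `]-oo, t[)
    = (unif B * unif (fst_half @^-1` `]-oo, t[))%E.
  apply: unif_indep; [exact: measurable_snd_half|by apply: mf; exact: measurable_itv| |exact: mB].
  move=> s; rewrite setIC; apply: (etrans (unif_quadrant t s)).
  rewrite muleC; congr mule; apply/esym/law_fst; exact: measurable_itv.
rewrite -law_snd; apply: unif_indep => //; [exact: measurable_fst_half|exact: ms|].
move=> t; have := half_line t; rewrite -law_snd setIC muleC law_fst//.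
Qed.

Definition stream (i : nat) : measurableTypeR R -> measurableTypeR R :=
  fun x => fst_half (iter i snd_half x).

End split.

(** Independence of initial segments gives that of all finite subfamilies,
    by taking some of the A i to be the whole line. *)
Definition iid_uniform d (T : measurableType d) (R : realType)
    (P : probability T R) (V : nat -> T -> measurableTypeR R) : Prop :=
  (forall i, measurable_fun setT (V i)) /\
  forall n (A : nat -> set (measurableTypeR R)), (forall i, measurable (A i)) ->
    P (\bigcap_(i in `I_n) V i @^-1` A i) = (\prod_(i < n) unif (A i))%E.

(** The first number is independent of the remaining digits, from which the
    next ones are computed in the same way. *)
Lemma iid_stream (R : realType) : iid_uniform (@unif R) (@stream R).
Proof.
have ms i : measurable_fun setT
    (fun x : measurableTypeR R => iter i (@snd_half R) x : measurableTypeR R).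
  elim: i => [|i IH]; first exact: measurable_id.
  exact: (measurableT_comp (@measurable_snd_half R) IH).
have mV i : measurable_fun setT (@stream R i).
  exact: (measurableT_comp (@measurable_fst_half R) (ms i)).
split=> //; elim=> [|n IH] A mA.
  by rewrite big_ord0 II0 bigcap_set0 probability_setT.
pose B i := A i.+1; rewrite big_ord_recl/= -[X in (_ * X)%E](IH B)/=; last first.
  by move=> i; exact: mA.
rewrite -unif_split//; last first.
  apply: bigcap_measurableType => i _.
  by rewrite -[X in measurable X]setTI; apply: mV => //; exact: mA.
congr unif; apply/seteqP; split => x.
  move=> h; split; first exact: (h 0%N).
  move=> i /= ni; rewrite /preimage/= /stream/= -iterSr; exact: (h i.+1).
move=> [h0 h] [|i] /= ni; first exact: h0.
by have := h i ni; rewrite /preimage/= /stream/= -iterSr.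
Qed.

(** * Exponential races *)

Lemma unif_itv_oc (R : realType) (a b : R) : 0 <= a -> a <= b -> b <= 1 ->
  unif `]a, b] = (b - a)%:E.
Proof.
move=> a0 ab b1; rewrite /unif /mrestr.
have [b1'|b1'] := ltP b 1.
  rewrite (_ : _ `&` _ = `]a, b]%classic).
    by rewrite lebesgue_measure_itv/= lte_fin; case: ltgtP ab => // -> _; rewrite subrr.
  apply/seteqP; split => x /=; rewrite !in_itv/=; first by case.
  move=> /andP[ax xb]; rewrite ax xb (le_trans a0 (ltW ax)) (le_lt_trans xb b1').
  by [].
have -> : b = 1 by apply/eqP; rewrite eq_le b1 b1'.
rewrite (_ : _ `&` _ = `]a, 1[%classic).
  have a1 := le_trans ab b1.
  by rewrite lebesgue_measure_itv/= lte_fin; case: ltgtP a1 => // -> _; rewrite subrr.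
apply/seteqP; split => x /=; rewrite !in_itv/=.
  by move=> [/andP[-> _] /andP[_ ->]].
by move=> /andP[ax xb]; rewrite ax xb ltW// (le_trans a0 (ltW ax)).
Qed.

Section race.
Context d (T : measurableType d) (R : realType) (P : probability T R).
Variable V : nat -> T -> measurableTypeR R.
Hypothesis iidV : iid_uniform P V.

(** Exponential of rate 1; the maximum makes it nonnegative also on the null
    set where V i u exceeds 1. *)
Definition clock (i : nat) (u : T) : R := Num.max 0 (- ln (V i u)).

Let mV i : measurable_fun setT (V i). Proof. exact: iidV.1. Qed.

Lemma measurable_clock i : measurable_fun setT (clock i : T -> measurableTypeR R).
Proof.
apply: measurable_maxr; first exact: measurable_cst.
apply: measurableT_comp; first exact: oppr_measurable.
by apply: measurableT_comp; [exact: measurable_ln|exact: mV].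
Qed.

Lemma measurable_race (x y : R) i j :
  measurable [set u | x * clock i u < y * clock j u].
Proof.
have mc k z : measurable_fun setT (fun u => z * clock k u).
  by apply: measurable_funM; [exact: measurable_cst|exact: measurable_clock].
rewrite -[X in measurable X]setTI.
exact: (measurable_fun_ltr (mc i x) (mc j y) measurableT (_ : measurable [set true])).
Qed.

(** Clock n rings before its competitors in D, competitor i having the rate
    w i relative to n.  A competitor of rate 0 never rings. *)
Definition wins (w : nat -> R) (n : nat) (D : set nat) : set T :=
  \bigcap_(i in [set i | D i /\ i <> n /\ 0 < w i])
    [set u | w i * clock n u < 1 * clock i u].

Lemma measurable_wins w n D : measurable (wins w n D).
Proof. by apply: bigcap_measurableType => i _; exact: measurable_race. Qed.

Lemma clock_cell (s e : R) i u : 0 <= s ->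
  V i u \in `]expR (- (s + e)), expR (- s)] ->
  s <= clock i u < s + e.
Proof.
rewrite in_itv/= => s0 /andP[lo up]; have V0 := lt_trans (expR_gt0 _) lo.
have e0 : 0 < s + e.
  by have := lt_le_trans lo up; rewrite ltr_expR ltrN2; exact: le_lt_trans.
rewrite /clock (max_idPr _); last first.
  by rewrite (le_trans s0)// lerNr -ler_expR lnK.
apply/andP; split.
  by rewrite lerNr -ler_expR lnK.
by rewrite ltrNl -ltr_expR lnK.
Qed.

Lemma clock_ge0 i u : 0 <= clock i u.
Proof. by rewrite le_max lexx. Qed.

(** Clock n rings between j e and j e + e, its competitors below N later. *)
Let cell (w : nat -> R) (n N : nat) (e : R) (j : nat) : set T :=
  \bigcap_(i in `I_N) V i @^-1`
    [set` if i == n then `]expR (- (j%:R * e + e)), expR (- (j%:R * e))]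
                    else `]0, expR (- (w i * (j%:R * e + e)))] ].

Let unif_cell w n N e j : (n < N)%N -> 0 < e -> (forall i, 0 <= w i) ->
  P (cell w n N e j) =
  (expR (- (j%:R * e)) * (1 - expR (- e)) *
    expR (- ((\sum_(i < N | i != n :> nat) w i) * (j%:R * e + e))))%:E.
Proof.
move=> nN e0 w0; rewrite /cell iidV.2; last first.
  by move=> i; case: ifP => _; exact: measurable_itv.
rewrite (bigD1 (Ordinal nN))//= eqxx.
have je : 0 <= j%:R * e by rewrite mulr_ge0// ltW.
rewrite unif_itv_oc ?expR_ge0//; last 2 first.
- by rewrite ler_expR lerN2 lerDl ltW.
- by rewrite expR_le1 oppr_le0.
rewrite (eq_bigr (fun i : 'I_N => (expR (- (w i * (j%:R * e + e))))%:E)); last first.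
  move=> i /negbTE; rewrite -(inj_eq val_inj)/= => ->.
  rewrite unif_itv_oc ?subr0 ?expR_ge0// expR_le1 oppr_le0 mulr_ge0//.
  by rewrite addr_ge0// ltW.
rewrite prodEFin -EFinM -expR_sum opprD expRD; congr EFin.
rewrite mulr_suml -sumrN; congr (_ * expR _).
  by rewrite mulrBr mulr1.
Qed.

Let cell_wins w n N e j : 0 < e -> (forall i, 0 <= w i) -> (n < N)%N ->
  cell w n N e j `<=` wins w n `I_N.
Proof.
move=> e0 w0 nN u cu i [/= iN [/eqP/negbTE ni wi]].
have je k : 0 <= k%:R * e :> R by rewrite mulr_ge0// ltW.
have := cu n nN; rewrite /= eqxx => /(clock_cell (je j))/andP[_ h].
have := cu i iN; rewrite /= ni => h2.
have h3 : w i * (j%:R * e + e) <= clock i u.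
  move: h2; rewrite in_itv/= => /andP[V0 up].
  by rewrite /clock le_max lerNr -[X in _ || X]ler_expR lnK ?orbT// up orbT.
by rewrite mul1r (lt_le_trans _ h3)// ltr_pM2l.
Qed.

Let trivIset_cell w n N e : 0 < e -> (n < N)%N -> trivIset setT (cell w n N e).
Proof.
move=> e0 nN; apply/trivIsetP => i j _ _ ij; rewrite -subset0 => u [hi hj].
have je k : 0 <= k%:R * e :> R by rewrite mulr_ge0// ltW.
have := hi n nN; rewrite /= eqxx => /(clock_cell (je _))/andP[a1 a2].
have := hj n nN; rewrite /= eqxx => /(clock_cell (je _))/andP[b1 b2].
have h1 := le_lt_trans a1 b2; have h2 := le_lt_trans b1 a2.
have succ k : k%:R * e + e = k.+1%:R * e by rewrite -natr1 mulrDl mul1r.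
move: h1 h2; rewrite !succ !ltr_pM2r// !ltr_nat.
by move: ij => /eqP; lia.
Qed.

Let measurable_cell w n N e j : measurable (cell w n N e j).
Proof.
apply: bigcap_measurableType => i _; rewrite -[X in measurable X]setTI.
by apply: mV => //; exact: measurable_itv.
Qed.

(** The cells are disjoint, and their probabilities dominate a geometric
    progression of ratio exp (- e (1 + a)). *)
Let wins_ge_cells (w : nat -> R) n N (e : R) (J : nat) (a : R) :
  (n < N)%N -> 0 < e -> (forall i, 0 <= w i) ->
  \sum_(i < N | i != n :> nat) w i <= a ->
  ((1 - expR (- (e * (1 + a))) ^+ J) * expR (- (e * (1 + a))) <=
   (1 + a) * fine (P (wins w n `I_N))).
Proof.
move=> nN e0 w0 ha.
have a0 : 0 <= a by apply: le_trans ha; apply: sumr_ge0.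
set y := expR (- (e * (1 + a))).
have cell_ge (j : 'I_J) :
    ((y ^+ j * (1 - expR (- e)) * expR (- (e * a)))%R%:E <= P (cell w n N e j))%E.
  rewrite unif_cell// lee_fin -mulrA [leRHS]mulrAC [leRHS]mulrC.
  rewrite [leLHS]mulrCA; apply: ler_wpM2l.
    by rewrite subr_ge0 expR_le1 oppr_le0 ltW.
  rewrite -expRM_natl -!expRD ler_expR.
  have je : 0 <= j%:R * e + e by rewrite addr_ge0 ?mulr_ge0// ltW.
  by have := ler_wpM2r je ha; lra.
have : \sum_(j < J) (y ^+ j * (1 - expR (- e)) * expR (- (e * a))) <=
    fine (P (wins w n `I_N)).
  rewrite -lee_fin fineK ?fin_num_measure//; last exact: measurable_wins.
  rewrite -sumEFin.
  apply: (@le_trans _ _ (P (\big[setU/set0]_(j < J) cell w n N e j))).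
    rewrite measure_bigsetU_ord//; last first.
      apply/trivIsetP => i j _ _ ij.
      by move/trivIsetP : (@trivIset_cell w n N e e0 nN); apply.
    by apply: lee_sum => j _; exact: cell_ge.
  apply: le_measure; rewrite ?inE.
  - by apply: bigsetU_measurable => j _.
  - exact: measurable_wins.
  - by rewrite -bigcup_mkord; apply: bigcup_sub => j _; exact: cell_wins.
rewrite -!mulr_suml; set S := \sum_(j < J) _ => hp.
have S0 : 0 <= S by apply: sumr_ge0 => j _; rewrite exprn_ge0// expR_ge0.
have -> : 1 - y ^+ J = (1 - y) * S by rewrite -opprB subrX1 -mulNr opprB.
set x := expR (- e) in hp; set z := expR (- (e * a)) in hp.
have yE : y = x * z by rewrite -expRD; congr expR; lra.
have x0 : 0 < x by exact: expR_gt0.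
have y0 : 0 < y by exact: expR_gt0.
have z0 : 0 < z by exact: expR_gt0.
have hx : e * x <= 1 - x.
  rewrite lerBrDr -[X in _ + X]mul1r -mulrDl -ler_pdivlMr// div1r -expRN opprK.
  by rewrite addrC expR_ge1Dx.
have hy : 1 - y <= e * (1 + a) by have := expR_ge1Dx (- (e * (1 + a))); rewrite -/y; lra.
have h1 : (1 - y) * (S * y) <= e * (1 + a) * (S * y).
  by rewrite ler_wpM2r// mulr_ge0// ltW.
rewrite -mulrA (le_trans h1)//.
have h2 : e * x * (S * z) <= (1 - x) * (S * z).
  by rewrite ler_wpM2r// mulr_ge0// ltW.
have h3 : e * (S * y) <= S * (1 - x) * z.
  rewrite yE (_ : e * _ = e * x * (S * z)); last by ring.
  by rewrite (_ : S * _ * z = (1 - x) * (S * z))//; ring.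
rewrite [e * _]mulrC -mulrA ler_wpM2l ?addr_ge0//.
exact: le_trans hp.
Qed.

(** If clock n rings at time t, competitor i is still running with probability
    exp (- w i t), so that the probability of a win is the integral of
    exp (- t (1 + sum w)).  A lower bound suffices for the sequel, and Riemann
    sums over cells of length e provide it. *)
Lemma wins_ge (w : nat -> R) n (a : R) : (forall i, 0 <= w i) ->
  (forall N, \sum_(i < N | i != n :> nat) w i <= a) ->
  ((1 + a)^-1%:E <= P (wins w n setT))%E.
Proof.
move=> w0 ha.
have a0 : 0 <= a by have := ha 0%N; rewrite big_ord0.
have fin N : (n < N)%N -> ((1 + a)^-1%:E <= P (wins w n `I_N))%E.
  move=> nN; have mw := measurable_wins w n `I_N.
  rewrite -[leRHS]fineK ?fin_num_measure// lee_fin.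
  set p := fine _; have hp := fun e J e0 => @wins_ge_cells w n N e J a nN e0 w0 (ha N).
  rewrite -div1r ler_pdivrMr ?ltr_wpDr// mulrC.
  apply/ler_addgt0Pr => c c0.
  (* cells of length 1 / K up to time K: both errors are O(1 / K) *)
  set K : R := (Num.truncn ((2 + a) / c)).+1%:R.
  have K0 : 0 < K by rewrite ltr0n.
  have hK : (2 + a) / K <= c.
    by rewrite ler_pdivrMr// mulrC -ler_pdivrMr//; exact/ltW/truncnS_gt.
  set k := (Num.truncn _).+1 in K K0 hK.
  have Ki0 : 0 < K^-1 by rewrite invr_gt0.
  have := hp K^-1 (k ^ 2)%N Ki0; set y := expR _.
  have -> : y ^+ (k ^ 2) = expR (- (K * (1 + a))).
    rewrite -expRM_natl natrX -/K; congr expR.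
    by rewrite mulrN mulrA expr2 -[_ * _ * K^-1]mulrA divff ?mulr1// gt_eqF.
  have y1 : y <= 1 by rewrite expR_le1 oppr_le0 mulr_ge0 ?addr_ge0// ltW.
  have hy : 1 - (1 + a) / K <= y.
    by have := expR_ge1Dx (- (K^-1 * (1 + a))); rewrite -/y [_ / K]mulrC.
  have hq : expR (- (K * (1 + a))) <= K^-1.
    rewrite expRN lef_pV2 ?posrE ?expR_gt0//.
    apply: le_trans (expR_ge1Dx _); have : 0 <= K * a by rewrite mulr_ge0// ltW.
    by lra.
  set q := expR _ in hq *; have q0 : 0 <= q by exact: expR_ge0.
  have hq' : q * y <= q by rewrite -[leRHS]mulr1 ler_wpM2l.
  by move: hK hy hq hq'; set Ki := K^-1; rewrite -/p; lra.
have -> : wins w n setT = \bigcap_k wins w n `I_(n.+1 + k).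
  apply/seteqP; split => u h.
    by move=> k _ i [_ hi]; apply: h; split.
  by move=> i [_ hi]; apply: (h i Logic.I); split=> //=; rewrite ltnS leq_addl.
have mF k : measurable (wins w n `I_(n.+1 + k)) by exact: measurable_wins.
have cv : P \o (fun k => wins w n `I_(n.+1 + k)) @ \oo -->
    P (\bigcap_k wins w n `I_(n.+1 + k)).
  apply: nonincreasing_cvg_mu => //.
  - by rewrite -ge0_fin_numE// fin_num_measure.
  - exact: bigcapT_measurable.
  - move=> k l kl; apply/subsetPset => u h i [/= il hi]; apply: h; split=> //=.
    by rewrite (leq_trans il)// leq_add2l.
rewrite -(cvg_lim _ cv)//; apply: lime_ge; first exact: cvgP cv.
by apply: nearW => k; apply: fin; rewrite ltn_addr.
Qed.

End race.

(** * Coupled selection from distributions on the natural numbers *)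

(** Lower bounds that already add up to the total mass are equalities. *)
Lemma mass_squeeze (R : realType) (a p : nat -> \bar R) :
  (forall n, 0 <= p n)%E -> (forall n, p n <= a n)%E ->
  (\sum_(n <oo) a n <= 1)%E -> (\sum_(n <oo) p n = 1)%E ->
  forall n, a n = p n.
Proof.
move=> p0 pa a1 p1 n; apply/eqP; rewrite eq_le pa andbT.
have a0 k : (0 <= a k)%E := le_trans (p0 k) (pa k).
have := a1; rewrite (@nneseriesD1 _ _ n)//.
move: p1; rewrite (@nneseriesD1 _ _ n)//.
set s := (\sum_(_ <oo | _) _)%E; set t := (\sum_(_ <oo | _) _)%E.
have st : (s <= t)%E by apply: lee_nneseries.
have s0 : (0 <= s)%E by apply: nneseries_ge0.
move=> e h.
have sfin : s \is a fin_num.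
  rewrite ge0_fin_numE//; apply: (@le_lt_trans _ _ (1%E : \bar R)); last by rewrite ltry.
  by rewrite -e leeDr.
rewrite -(leeD2rE _ _ sfin) e (le_trans _ h)// leeD2l//.
Qed.

Definition mass_function (R : realType) (p : nat -> R) : Prop :=
  (forall n, 0 <= p n) /\ (\sum_(n <oo) (p n)%:E = 1)%E.

Lemma mass_function_partial (R : realType) (p : nat -> R) N :
  mass_function p -> \sum_(i < N) p i <= 1.
Proof.
move=> [p0 p1]; rewrite -lee_fin -p1 -sumEFin -(big_mkord xpredT (fun i => (p i)%:E)).
by apply: nneseries_lim_ge => i _; rewrite lee_fin.
Qed.

Lemma sum_except_le (R : realType) (f : nat -> R) (M : R) N n :
  (forall i, 0 <= f i) -> (forall k, \sum_(i < k) f i <= M) ->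
  \sum_(i < N | i != n :> nat) f i + f n <= M.
Proof.
move=> f0 hM; apply: le_trans (hM (maxn N n.+1)).
rewrite [leRHS](bigD1 (Ordinal (leq_maxr N n.+1)))//= [leRHS]addrC lerD2r.
rewrite (big_ord_widen_cond _ (fun i => i != n) f (leq_maxl N n.+1)).
rewrite [leRHS](bigID (fun i : 'I__ => (i < N)%N))/=.
rewrite (eq_bigl (fun i : 'I_(maxn N n.+1) =>
  (i != Ordinal (leq_maxr N n.+1)) && (i < N)%N))// lerDl sumr_ge0//.
Qed.

Section selection.
Context d (T : measurableType d) (R : realType) (P : probability T R).
Variable V : nat -> T -> measurableTypeR R.
Hypothesis iidV : iid_uniform P V.

(** The letter n has a clock of rate p n, and rings first. *)
Definition win (p : nat -> R) (n : nat) : set T :=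
  [set u | 0 < p n /\
    forall i, i <> n -> 0 < p i -> p i * clock V n u < p n * clock V i u].

Lemma win_uniq p m n u : win p m u -> win p n u -> m = n.
Proof.
move=> [pm hm] [pn hn]; apply: contrapT => mn.
have h1 := hm n (fun e => mn (esym e)) pn; have h2 := hn m mn pm.
by have := lt_trans h1 h2; rewrite ltxx.
Qed.

Lemma win_wins p n : 0 < p n -> win p n = wins V (fun i => p i / p n) n setT.
Proof.
move=> pn; apply/seteqP; split => u.
  move=> [_ h] i [_ [ni]]; rewrite pmulr_lgt0 ?invr_gt0// => pi /=.
  by rewrite mul1r mulrAC ltr_pdivrMr// [_ * p n]mulrC; exact: h.
move=> h; split=> // i ni pi.
have := h i; rewrite /= mul1r mulrAC ltr_pdivrMr// [_ * p n]mulrC; apply.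
by split=> //; split=> //; rewrite divr_gt0.
Qed.

Lemma measurable_win p n : measurable (win p n).
Proof.
have [pn|pn] := boolP (0 < p n).
  by rewrite win_wins//; exact: (measurable_wins iidV).
rewrite (_ : win p n = set0)// -subset0 => u [h _].
by rewrite h in pn.
Qed.

Lemma win_ge p n : mass_function p -> ((p n)%:E <= P (win p n))%E.
Proof.
move=> pp; have [p0 p1] := pp; have [pn|pn] := boolP (0 < p n); last first.
  by rewrite (_ : p n = 0)//; apply/eqP; rewrite eq_le p0 andbT leNgt.
rewrite win_wins//.
have -> : (p n)%:E = ((1 + ((p n)^-1 - 1))^-1)%:E by rewrite addrC subrK invrK.
apply: (wins_ge iidV) => [i|N]; first by rewrite divr_ge0.
rewrite -mulr_suml ler_pdivrMr// mulrBl mulVf ?gt_eqF// mul1r lerBrDr.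
by apply: sum_except_le => // k; exact: mass_function_partial.
Qed.

(** The clocks are common to all p, which is what makes the letters selected
    for two close distributions agree with high probability. *)
Definition select (p : nat -> R) (u : T) : nat := xget 0%N [set n | win p n u].

Lemma select_win p n u : win p n u -> select p u = n.
Proof. by move=> h; apply: xget_unique => // m hm; exact: win_uniq hm h. Qed.

Lemma measurable_select p n : measurable [set u | select p u = n].
Proof.
have [->|n0] := eqVneq n 0%N; last first.
  rewrite (_ : [set u | _] = win p n); first exact: measurable_win.
  apply/seteqP; split => u /=; last exact: select_win.
  rewrite /select; case: xgetP => [m -> hm <-//|_ e].
  by move: n0; rewrite -e eqxx.
rewrite (_ : [set u | _] = win p 0 `|` \bigcap_m ~` win p m).
  apply: measurableU; first exact: measurable_win.
  by apply: bigcapT_measurable => m; apply: measurableC; exact: measurable_win.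
apply/seteqP; split => u /=.
  rewrite /select; case: xgetP => [m -> hm <-|h _]; [by left|right].
  by move=> m _; exact: h.
move=> [|h]; first exact: select_win.
rewrite /select; case: xgetP => // m _ hm; exfalso; exact: (h m Logic.I hm).
Qed.

Lemma trivIset_select p : trivIset setT (fun n => [set u | select p u = n]).
Proof.
by apply/trivIsetP => i j _ _ /eqP ij; rewrite -subset0 => u /= [-> /ij].
Qed.

Lemma select_law p n : mass_function p -> P [set u | select p u = n] = (p n)%:E.
Proof.
move=> pp; apply: (@mass_squeeze _ (fun n => P [set u | select p u = n])
    (fun n => (p n)%:E)); last exact: pp.2.
- by move=> k; rewrite lee_fin; exact: pp.1.
- move=> k; apply: le_trans (win_ge k pp) _; apply: le_measure; rewrite ?inE.
  + exact: measurable_win.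
  + exact: measurable_select.
  + by move=> u /= /select_win.
- rewrite -measure_semi_bigcup.
  + by apply: probability_le1; apply: bigcupT_measurable => k; exact: measurable_select.
  + by move=> k; exact: measurable_select.
  + exact: trivIset_select.
  + by apply: bigcupT_measurable => k; exact: measurable_select.
Qed.

(** Letter n wins both races as soon as it wins the race against competitors
    of relative rates max (p i / p n) (q i / q n). *)
Lemma win2_ge p q n M : mass_function p -> mass_function q ->
  (forall N, \sum_(i < N) Num.max (p i) (q i) <= M) ->
  ((Num.min (p n) (q n) / M)%R%:E <= P (win p n `&` win q n))%E.
Proof.
move=> pp qq hM; have [p0 _] := pp; have [q0 _] := qq.
set m := Num.min _ _.
have [m0|m0] := ltP 0 m; last first.
  rewrite (_ : m = 0) ?mul0r//; apply/eqP; rewrite eq_le m0.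
  by rewrite le_min p0 q0.
have pn : 0 < p n by rewrite (lt_le_trans m0)// ge_min lexx.
have qn : 0 < q n by rewrite (lt_le_trans m0)// ge_min lexx orbT.
pose w i := Num.max (p i / p n) (q i / q n).
have w0 i : 0 <= w i by rewrite le_max divr_ge0.
apply: (@le_trans _ _ (P (wins V w n setT))); last first.
  apply: le_measure; rewrite ?inE.
  - exact: (measurable_wins iidV).
  - by apply: measurableI; exact: measurable_win.
  - have c0 u : 0 <= clock V n u by exact: clock_ge0.
    move=> u h; split; rewrite win_wins// => i [_ [ni hi]] /=.
      have hw : p i / p n <= w i by rewrite le_max lexx.
      apply: (@le_lt_trans _ _ (w i * clock V n u)); first by rewrite ler_wpM2r.
      by apply: h; split=> //; split=> //; exact: lt_le_trans hw.
    have hw : q i / q n <= w i by rewrite le_max lexx orbT.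
    apply: (@le_lt_trans _ _ (w i * clock V n u)); first by rewrite ler_wpM2r.
    by apply: h; split=> //; split=> //; exact: lt_le_trans hw.
have M0 : 0 < M.
  apply: lt_le_trans m0 _; apply: le_trans (hM n.+1).
  rewrite big_ord_recr/= ler_wpDl ?sumr_ge0// => [i _|].
    by rewrite le_max p0.
  by rewrite /m ge_min le_max lexx.
have -> : m / M = (1 + (M / m - 1))^-1 by rewrite addrC subrK invf_div.
apply: (wins_ge iidV) => // N.
apply: (@le_trans _ _ (\sum_(i < N | i != n :> nat) Num.max (p i) (q i) / m)).
  apply: ler_sum => i _; rewrite ge_max; apply/andP; split.
    by apply: ler_pM; rewrite ?invr_ge0// ?le_max ?lexx// lef_pV2 ?posrE// ge_min lexx.
  apply: ler_pM; rewrite ?invr_ge0// ?le_max ?lexx ?orbT//.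
  by rewrite lef_pV2 ?posrE// ge_min lexx orbT.
rewrite -mulr_suml ler_pdivrMr// mulrBl divfK ?gt_eqF// mul1r lerBrDr.
apply: (@le_trans _ _ (\sum_(i < N | i != n :> nat) Num.max (p i) (q i)
                        + Num.max (p n) (q n))).
  by rewrite lerD2l /m ge_min le_max lexx.
by apply: (@sum_except_le _ (fun i => Num.max (p i) (q i))) => // i; rewrite le_max p0.
Qed.

Definition l1dist (p q : nat -> R) : \bar R := (\sum_(n <oo) `|p n - q n|%:E)%E.

(** Write D for the l1 distance.  Summing [win2_ge] over n, the two letters
    agree with probability at least sum min / sum max, that is
    (1 - D / 2) / (1 + D / 2), which is at least 1 - D. *)
Lemma select_coupling p q : mass_function p -> mass_function q ->
  (P [set u | select p u <> select q u] <= l1dist p q)%E.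
Proof.
move=> pp qq; have [p0 p1] := pp; have [q0 q1] := qq.
have meq : measurable [set u | select p u = select q u].
  rewrite (_ : [set u | _] = \bigcup_n ([set u | select p u = n] `&`
                                        [set u | select q u = n])).
    by apply: bigcupT_measurable => n; apply: measurableI; exact: measurable_select.
  apply/seteqP; split => u /=; last by move=> [n _ [/= -> ->]].
  by move=> e; exists (select p u).
rewrite (_ : [set u | _] = ~` [set u | select p u = select q u])//.
rewrite probability_setC//.
have maxE n : (Num.max (p n) (q n))%:E =
    (2^-1%:E * ((p n)%:E + (q n)%:E + `|p n - q n|%:E))%E.
  rewrite -!EFinD -EFinM; congr EFin.
  by case: (leP (p n) (q n)) => h; [rewrite ler0_norm ?subr_le0//|
    rewrite ger0_norm ?subr_ge0 ?ltW//]; lra.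
have minE n : (Num.min (p n) (q n) + `|p n - q n| / 2)%:E =
    (2^-1%:E * ((p n)%:E + (q n)%:E))%E.
  rewrite -!EFinD -EFinM; congr EFin.
  by case: (leP (p n) (q n)) => h; [rewrite ler0_norm ?subr_le0//|
    rewrite ger0_norm ?subr_ge0 ?ltW//]; lra.
have min0 n : (0 <= Num.min (p n) (q n)) by rewrite le_min p0 q0.
have Dfin : l1dist p q \is a fin_num.
  rewrite ge0_fin_numE; last by apply: nneseries_ge0.
  apply: (@le_lt_trans _ _ (\sum_(n <oo) ((p n)%:E + (q n)%:E))%E).
    apply: lee_nneseries => // n _; rewrite -EFinD lee_fin.
    by rewrite (le_trans (ler_normB _ _))// !ger0_norm.
  rewrite nneseriesD//; [|by move=> i; rewrite lee_fin..].
  by rewrite p1 q1 ltry.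
set D := fine (l1dist p q).
have DE : l1dist p q = D%:E by rewrite fineK.
have D0 : 0 <= D by rewrite -lee_fin -DE; apply: nneseries_ge0.
have sum_max : (\sum_(n <oo) (Num.max (p n) (q n))%:E = (1 + D / 2)%:E)%E.
  under eq_eseriesr do rewrite maxE.
  rewrite nneseriesZl; last by move=> n _; rewrite -!EFinD lee_fin !addr_ge0.
  rewrite nneseriesD//; [|by move=> i; rewrite -?EFinD lee_fin// addr_ge0..].
  rewrite nneseriesD//; [|by move=> i; rewrite lee_fin..].
  rewrite p1 q1 -/(l1dist p q) DE -!EFinD -EFinM; congr EFin; lra.
have sum_min : (\sum_(n <oo) (Num.min (p n) (q n))%:E = (1 - D / 2)%:E)%E.
  have : (\sum_(n <oo) (Num.min (p n) (q n) + `|p n - q n| / 2)%:E = 1)%E.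
    under eq_eseriesr do rewrite minE.
    rewrite nneseriesZl; last by move=> n _; rewrite -!EFinD lee_fin !addr_ge0.
    rewrite nneseriesD//; [|by move=> i; rewrite lee_fin..].
    by rewrite p1 q1 -EFinD -EFinM; congr EFin; lra.
  under eq_eseriesr do rewrite EFinD [_ / _]mulrC EFinM.
  rewrite nneseriesD//; [|by move=> i; rewrite -?EFinM lee_fin// mulr_ge0..].
  rewrite nneseriesZl// -/(l1dist p q) DE -EFinM => h.
  have -> : ((1 - D / 2)%:E = 1 - (D / 2)%:E)%E by [].
  by rewrite -h [D / 2]mulrC addeK.
have max_partial N : \sum_(i < N) Num.max (p i) (q i) <= 1 + D / 2.
  rewrite -lee_fin -sum_max -sumEFin.
  rewrite -(big_mkord xpredT (fun i => (Num.max (p i) (q i))%:E)).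
  by apply: nneseries_lim_ge => i _; rewrite lee_fin le_max p0.
have M0 : 0 < 1 + D / 2 by rewrite ltr_pwDl// divr_ge0.
have eq_ge : (((1 - D / 2) / (1 + D / 2))%R%:E <=
    P [set u | select p u = select q u])%E.
  apply: (@le_trans _ _ (\sum_(n <oo) P (win p n `&` win q n))%E).
    have -> : ((1 - D / 2) / (1 + D / 2))%R%:E =
        (\sum_(n <oo) (Num.min (p n) (q n) / (1 + D / 2))%R%:E)%E.
      under eq_eseriesr do rewrite mulrC EFinM.
      rewrite nneseriesZl; last by move=> i _; rewrite lee_fin.
      by rewrite sum_min -EFinM mulrC.
    apply: lee_nneseries => n _; last exact: win2_ge.
    by rewrite lee_fin divr_ge0// ltW.
  rewrite -measure_semi_bigcup//; last 3 first.
  - by move=> i; apply: measurableI; exact: measurable_win.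
  - apply/trivIsetP => i j _ _ /eqP ij; rewrite -subset0 => u [[a _] [b _]].
    exact/ij/(win_uniq a b).
  - by apply: bigcupT_measurable => i; apply: measurableI; exact: measurable_win.
  apply: le_measure; rewrite ?inE//.
    by apply: bigcupT_measurable => i; apply: measurableI; exact: measurable_win.
  by move=> u [n _ [a b]] /=; rewrite (select_win a) (select_win b).
have [x xE] : exists x, P [set u | select p u = select q u] = x%:E.
  by eexists; rewrite -[LHS]fineK ?fin_num_measure.
move: eq_ge; rewrite xE DE lee_fin -EFinB lee_fin ler_pdivrMr// => h.
nra.
Qed.

End selection.

(** * Tails of independent sequences *)

Section iid.
Context d (T : measurableType d) (R : realType) (P : probability T R).

Lemma iid_seq (V : nat -> T -> measurableTypeR R) (s : seq nat)
    (A : nat -> set (measurableTypeR R)) :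
  iid_uniform P V -> uniq s -> (forall i, measurable (A i)) ->
  P (\bigcap_(i in [set` s]) V i @^-1` A i) = (\prod_(i <- s) unif (A i))%E.
Proof.
move=> [mV iidV] us mA.
pose B i := if i \in s then A i else setT.
have mB i : measurable (B i) by rewrite /B; case: ifP.
have [N sN] : exists N, forall i, i \in s -> (i < N)%N.
  exists (\max_(i <- s) i).+1 => i si; rewrite ltnS.
  by apply: (@leq_bigmax_seq _ _ _ (fun i => i)).
transitivity (P (\bigcap_(i in `I_N) V i @^-1` B i)).
  congr (P _); apply/seteqP; split => u h i /=.
    by move=> _; rewrite /B; case: ifPn => // si; exact: (h i).
  by move=> si; have := h i (sN i si); rewrite /B si.
rewrite iidV// -(big_mkord xpredT (fun i => unif (B i))).
rewrite (eq_bigr (fun i => if i \in s then unif (A i) else 1%E)); last first.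
  by move=> i _; rewrite /B; case: ifP => // _; rewrite probability_setT.
rewrite -big_mkcond -big_filter; apply: perm_big; apply: uniq_perm => //.
  by rewrite filter_uniq// iota_uniq.
move=> i; rewrite mem_filter mem_iota subn0 add0n/=.
by case: (boolP (i \in s)) => //= /sN.
Qed.

Lemma iid_reindex (V : nat -> T -> measurableTypeR R) (c : nat -> nat) :
  injective c -> iid_uniform P V -> iid_uniform P (fun i => V (c i)).
Proof.
move=> cI iidV; split=> [i|n A mA]; first exact: iidV.1.
pose B j := A (xget 0%N [set i | c i = j]).
have BE i : B (c i) = A i.
  by congr A; apply: xget_unique => // j /cI.
transitivity (P (\bigcap_(i in [set` map c (iota 0 n)]) V i @^-1` B i)).
  congr (P _); apply/seteqP; split => u h i /=.
    move=> /mapP[j]; rewrite mem_iota/= add0n => jn ->; rewrite BE.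
    exact: h.
  move=> ni; rewrite -BE; apply: h; apply/mapP; exists i => //.
  by rewrite mem_iota.
rewrite iid_seq//.
- by rewrite big_map -(big_mkord xpredT (fun i => unif (A i))) /index_iota subn0;
    apply: eq_bigr => i _; rewrite BE.
- by rewrite map_inj_uniq// iota_uniq.
- by move=> i; exact: mA.
Qed.

(** Both sides are limits of finite products. *)
Lemma iid_tail_indep (V : nat -> T -> measurableTypeR R)
    (E : set (measurableTypeR R)) (A : nat -> set (measurableTypeR R)) :
  iid_uniform P V -> measurable E -> (forall i, measurable (A i)) ->
  P (V 0%N @^-1` E `&` \bigcap_i V i.+1 @^-1` A i) =
  (unif E * P (\bigcap_i V i.+1 @^-1` A i))%E.
Proof.
move=> iidV mE mA; have [mV hV] := iidV.
have mVA i B : measurable B -> measurable (V i @^-1` B).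
  by move=> mB; rewrite -[X in measurable X]setTI; exact: mV.
pose F N := \bigcap_(i in `I_N) V i.+1 @^-1` A i.
have mF N : measurable (F N).
  by apply: bigcap_measurableType => i _; exact: mVA.
have FE : \bigcap_i V i.+1 @^-1` A i = \bigcap_N F N.
  apply/seteqP; split => u h; first by move=> N _ i _; exact: h.
  by move=> i _; apply: (h i.+1 Logic.I) => /=.
have F_dec : nonincreasing_seq F.
  move=> m n mn; apply/subsetPset => u h i /= im; apply: h => /=.
  exact: leq_trans im mn.
have cF : P \o F @ \oo --> P (\bigcap_N F N).
  apply: nonincreasing_cvg_mu => //.
  - by rewrite -ge0_fin_numE// fin_num_measure.
  - exact: bigcapT_measurable.
have cEF : P \o (fun N => V 0%N @^-1` E `&` F N) @ \oo -->
    P (\bigcap_N (V 0%N @^-1` E `&` F N)).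
  have mEF N : measurable (V 0%N @^-1` E `&` F N).
    by apply: measurableI => //; exact: mVA.
  apply: nonincreasing_cvg_mu => //.
  - by rewrite -ge0_fin_numE// fin_num_measure.
  - exact: bigcapT_measurable.
  - by move=> m n mn; apply/subsetPset; apply: setIS; apply/subsetPset/F_dec.
have -> : V 0%N @^-1` E `&` \bigcap_i V i.+1 @^-1` A i =
    \bigcap_N (V 0%N @^-1` E `&` F N).
  rewrite FE; apply/seteqP; split => u.
    by move=> [h0 h] N _; split=> //; exact: h.
  by move=> h; split=> [|N _]; [have [] := h 0%N Logic.I|have [] := h N Logic.I].
rewrite FE; have prodE N : P (V 0%N @^-1` E `&` F N) = (unif E * P (F N))%E.
  have iidS : iid_uniform P (fun i => V i.+1).
    by apply: (@iid_reindex V succn) => //; exact: succn_inj.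
  rewrite /F iidS.2//.
  pose B i := if i is k.+1 then A k else E.
  have mB i : measurable (B i) by case: i.
  transitivity (P (\bigcap_(i in `I_N.+1) V i @^-1` B i)).
    congr (P _); apply/seteqP; split => u.
      by move=> [h0 h] [_|i iN]//; exact: h.
    move=> h; split; first exact: (h 0%N).
    by move=> i iN; exact: (h i.+1).
  by rewrite hV// big_ord_recl.
apply: (cvg_unique _ cEF) => //.
rewrite (_ : P \o _ = fun N => (unif E * (P \o F) N)%E); last first.
  by apply/funext => N /=; rewrite prodE.
by apply: cvgeZl => //; rewrite fin_num_measure.
Qed.

End iid.

(** * The balls of an ultrametric space *)

Lemma separable_net (R : realType) (X : completeMetricType R) : separable X ->
  exists e : nat -> X, forall x t, 0 < t -> exists n, mdist (e n) x < t.
Proof.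
move=> [D [/countable_injP[f fI] dD]].
exists (fun n => xget point [set x | D x /\ f x = n]) => x t t0.
have [||y [/interior_subset yx Dy]] := dD (ball x t)^°.
- by exists x; exact: nbhsx_ballx.
- exact: open_interior.
exists (f y).
case: xgetP => [z _ [Dz fz]|/(_ y)]; last by move=> h; exfalso; apply: h.
have -> : z = y by apply: fI => //; exact/mem_set.
by rewrite metric_sym; rewrite ballEmdist in yx.
Qed.

Section labels.
Variables (R : realType) (X : completeMetricType R) (e : nat -> X).
Hypothesis hultra : ultrametric (@mdist R X).
Hypothesis net : forall x t, 0 < t -> exists n, mdist (e n) x < t.
Implicit Types (x y z : X) (t : R) (P Q : probability (borel X) R).

Lemma ultra_lt x y z t : mdist x y < t -> mdist y z < t -> mdist x z < t.
Proof.
have [_ _ _ h] := hultra => xy yz.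
by apply: le_lt_trans (h x y z) _; rewrite gt_max xy yz.
Qed.

Lemma ultra_ball_eq x y t : mdist x y < t -> ball x t = ball y t.
Proof.
move=> xy; rewrite !ballEmdist; apply/seteqP; split => z /=.
  by move=> h; apply: ultra_lt h; rewrite metric_sym.
by move=> h; exact: ultra_lt h.
Qed.

(** The set of indices depends only on the ball of x of radius t, so that the
    chosen index names that ball. *)
Definition label t x : nat := xget 0%N [set n | mdist (e n) x < t].

Lemma label_dist t x : 0 < t -> mdist (e (label t x)) x < t.
Proof.
move=> t0; rewrite /label; case: xgetP => // h.
by have [n] := net x t0; move=> /h.
Qed.

Lemma label_eq t x y : 0 < t -> label t x = label t y <-> mdist x y < t.
Proof.
move=> t0; split => [xy|xy].
  apply: (@ultra_lt _ (e (label t x))).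
    by rewrite metric_sym; exact: label_dist.
  by rewrite xy; exact: label_dist.
rewrite /label; congr xget; apply/seteqP; split => n /= h.
  exact: ultra_lt xy.
by apply: ultra_lt h _; rewrite metric_sym.
Qed.

Definition block t n : set (borel X) := [set x | label t x = n].

Lemma ball_block t x : 0 < t -> ball x t = block t (label t x).
Proof.
move=> t0; rewrite ballEmdist; apply/seteqP; split => y /=.
  by move=> /(label_eq _ _ t0) ->.
by move=> /esym /(label_eq _ _ t0).
Qed.

Lemma block_center t n x : 0 < t -> block t n x -> label t (e n) = n.
Proof.
by move=> t0 <-; apply/label_eq => //; exact: label_dist.
Qed.

Lemma open_block t n : 0 < t -> open (block t n : set X).
Proof.
move=> t0; rewrite openE => x xn; rewrite /interior.
apply/nbhs_ballP; exists t => //= y; rewrite ball_block//.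
by rewrite /block /= xn.
Qed.

Lemma measurable_block t n : 0 < t -> measurable (block t n).
Proof. by move=> t0; apply: sub_sigma_algebra; exact: open_block. Qed.

Lemma measurable_ultraball x t : 0 < t -> measurable (ball x t : set (borel X)).
Proof. by move=> t0; rewrite ball_block//; exact: measurable_block. Qed.

Lemma trivIset_block t : trivIset setT (block t).
Proof.
apply/trivIsetP => i j _ _ /eqP ij; rewrite -subset0 => x [xi xj].
exact: ij (etrans (esym xi) xj).
Qed.

Lemma sum_block P t (A : set (borel X)) : 0 < t -> measurable A ->
  (\sum_(n <oo) P (A `&` block t n) = P A)%E.
Proof.
move=> t0 mA; have mAB n : measurable (A `&` block t n).
  by apply: measurableI => //; exact: measurable_block.
rewrite -measure_semi_bigcup//.
- congr (P _); apply/seteqP; split => [x [n _ []]//|x Ax].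
  by exists (label t x).
- exact/trivIset_setIl/trivIset_block.
- exact: bigcupT_measurable.
Qed.

(** A conditional law, replaced by a point mass when A is null so that it is
    a distribution in all cases. *)
Definition cond P (A : set (borel X)) t (n : nat) : R :=
  if fine (P A) == 0 then (n == 0%N)%:R
  else fine (P (A `&` block t n)) / fine (P A).

Definition mass P t n : R := fine (P (block t n)).

Lemma mass_function_cond P A t : 0 < t -> measurable A -> mass_function (cond P A t).
Proof.
move=> t0 mA; have mAB n : measurable (A `&` block t n).
  by apply: measurableI => //; exact: measurable_block.
have PA0 : 0 <= fine (P A) by rewrite fine_ge0.
rewrite /cond; case: eqVneq => [_|PA]; split.
- by [].
- rewrite (@nneseriesD1 _ _ 0%N)//= eseries0 ?adde0// => i _ i0.
  by rewrite (negbTE i0).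
- by move=> n; rewrite divr_ge0// fine_ge0.
- under eq_eseriesr do rewrite mulrC EFinM fineK ?fin_num_measure//.
  rewrite nneseriesZl// sum_block//.
  by rewrite -[X in (_ * X)%E]fineK ?fin_num_measure// -EFinM mulVf.
Qed.

(** On A, multiplying the conditional law of P by P A gives P back, whereas
    for Q it gives Q multiplied by P A / Q A, which is at most 1: the l1 change
    is Q A - P A. *)
Let cond_bound_le P Q A t : 0 < t -> measurable A -> fine (P A) <= fine (Q A) ->
  ((fine (P A))%:E * l1dist (cond P A t) (cond Q A t) <=
   \sum_(n <oo) `|fine (P (A `&` block t n)) - fine (Q (A `&` block t n))|%:E
   + `|fine (P A) - fine (Q A)|%:E)%E.
Proof.
move=> t0 mA PQ; have mAB n : measurable (A `&` block t n).
  by apply: measurableI => //; exact: measurable_block.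
have PA0 : 0 <= fine (P A) by rewrite fine_ge0.
have [P0|Pn0] := eqVneq (fine (P A)) 0.
  by rewrite P0 mul0e adde_ge0// nneseries_ge0.
have Pp : 0 < fine (P A) by rewrite lt_neqAle eq_sym Pn0.
have Qp : 0 < fine (Q A) by exact: lt_le_trans PQ.
rewrite -nneseriesZl//.
rewrite (_ : `|fine (P A) - fine (Q A)|%:E =
    \sum_(n <oo) ((1 - fine (P A) / fine (Q A))%R%:E * Q (A `&` block t n)))%E; last first.
  have h : 0 <= 1 - fine (P A) / fine (Q A) by rewrite subr_ge0 ler_pdivrMr// mul1r.
  rewrite nneseriesZl// sum_block// -[Q A]fineK ?fin_num_measure// -EFinM.
  by rewrite mulrBl mul1r divfK ?gt_eqF// distrC ger0_norm ?subr_ge0.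
rewrite -nneseriesD//; last first.
  by move=> n _ _; rewrite mule_ge0// lee_fin subr_ge0 ler_pdivrMr// mul1r.
apply: lee_nneseries => n _; first by rewrite -EFinM lee_fin mulr_ge0.
rewrite -[Q (A `&` block t n)]fineK ?fin_num_measure//.
rewrite -!EFinM -EFinD lee_fin /cond (negbTE Pn0) gt_eqF//.
set a := fine (P (_ `&` _)); set b := fine (Q (_ `&` _)).
have b0 : 0 <= b by rewrite fine_ge0.
rewrite -{1}(ger0_norm PA0) -normrM.
have -> : fine (P A) * (a / fine (P A) - b / fine (Q A)) =
    (a - b) + (1 - fine (P A) / fine (Q A)) * b by field; rewrite !gt_eqF.
apply: le_trans (ler_normD _ _) _; rewrite lerD2l normrM (ger0_norm b0).
by rewrite ger0_norm// subr_ge0 ler_pdivrMr// mul1r.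
Qed.

Lemma l1distC p q : l1dist p q = l1dist q p :> \bar R.
Proof. by apply: eq_eseriesr => n _; rewrite distrC. Qed.

Lemma cond_bound P Q A t : 0 < t -> measurable A ->
  (mine (P A) (Q A) * l1dist (cond P A t) (cond Q A t) <=
   \sum_(n <oo) `|fine (P (A `&` block t n)) - fine (Q (A `&` block t n))|%:E
   + `|fine (P A) - fine (Q A)|%:E)%E.
Proof.
move=> t0 mA; have fP := fin_num_measure P A mA; have fQ := fin_num_measure Q A mA.
case: (leP (P A) (Q A)) => h.
  rewrite -{1}[P A]fineK//; apply: cond_bound_le => //.
  by rewrite fine_le.
rewrite -{1}[Q A]fineK// l1distC distrC.
under eq_eseriesr do rewrite distrC.
by apply: cond_bound_le => //; rewrite fine_le// ltW.
Qed.

(** A block of radius r lies in a single block of the larger radius t, so that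
    each j receives a contribution from one n only. *)
Lemma sum_refine P Q r t : 0 < r -> r <= t ->
  (\sum_(n <oo) \sum_(j <oo) `|fine (P (block t n `&` block r j))
     - fine (Q (block t n `&` block r j))|%:E = l1dist (mass P r) (mass Q r))%E.
Proof.
move=> r0 rt; have t0 := lt_le_trans r0 rt.
rewrite nneseries_interchange//; apply: eq_eseriesr => j _.
have [[x xj]|noj] := pselect (exists x, block r j x); last first.
  have b0 : block r j = set0 by rewrite -subset0 => x xj; apply: noj; exists x.
  rewrite /mass b0 !measure0 subrr normr0 eseries0// => n _ _.
  by rewrite setI0 !measure0 subrr normr0.
have bI n : block t n `&` block r j = if n == label t x then block r j else set0.
  apply/seteqP; split => y.
    move=> [yn yj]; case: eqP => // /(_ _)[]//; rewrite -yn.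
    apply/label_eq => //; apply: lt_le_trans rt.
    by apply/label_eq => //; rewrite yj xj.
  case: eqP => // -> yj; split=> //; apply/label_eq => //.
  by apply: lt_le_trans rt; apply/label_eq => //; rewrite yj xj.
rewrite (@nneseriesD1 _ _ (label t x))//= bI eqxx eseries0 ?adde0// => i _ h.
by rewrite bI (negbTE h) !measure0 subrr normr0.
Qed.

Lemma measurable_dist_lt d (T : measurableType d) (D : set T)
    (f g : T -> borel X) t : 0 < t -> measurable D ->
  measurable_fun D f -> measurable_fun D g ->
  measurable (D `&` [set w | mdist (f w : X) (g w) < t]).
Proof.
move=> t0 mD mf mg.
rewrite (_ : _ `&` _ = \bigcup_n ((D `&` f @^-1` block t n) `&`
                                  (D `&` g @^-1` block t n))).
  apply: bigcupT_measurable => n; apply: measurableI.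
    exact: mf mD _ (measurable_block n t0).
  exact: mg mD _ (measurable_block n t0).
apply/seteqP; split => w.
  move=> [Dw /(label_eq _ _ t0) fg]; exists (label t (f w)) => //.
by move=> [n _ [[Dw fn] [_ gn]]]; split=> //; apply/(label_eq _ _ t0); rewrite fn gn.
Qed.

Lemma measurable_dist d (T : measurableType d) (D : set T) (f g : T -> borel X) :
  measurable D -> measurable_fun D f -> measurable_fun D g ->
  measurable_fun D (fun w => mdist (f w : X) (g w) : measurableTypeR R).
Proof.
move=> mD mf mg _.
apply: (measurability _ (RGenInftyO.measurableE R)) => //.
move=> _ [_ [t ->] <-]; have [t0|t0] := ltP 0 t.
  rewrite (_ : _ `&` _ = D `&` [set w | mdist (f w : X) (g w) < t]).
    exact: measurable_dist_lt.
  by apply/seteqP; split => w [Dw]; rewrite /= in_itv.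
rewrite (_ : _ `&` _ = set0)// -subset0 => w [_]; rewrite /= in_itv/= => h.
by have := lt_le_trans h t0; rewrite ltNge mdist_ge0.
Qed.

End labels.

(** * Sampling down the tree of balls *)

Section tree.
Variables (R : realType) (X : completeMetricType R) (e : nat -> X).
Hypothesis hultra : ultrametric (@mdist R X).
Hypothesis net : forall x t, 0 < t -> exists n, mdist (e n) x < t.
Context d (T : measurableType d) (mu : probability T R).
Variable W : int -> T -> measurableTypeR R.
Hypothesis iidW : forall k : int, iid_uniform mu (fun i : nat => W (k + i%:Z)).
Variable r : int -> R.
Hypothesis r_gt0 : forall k, 0 < r k.
Hypothesis r_homo : forall k (i : nat), r k <= r (k + i%:Z).
Hypothesis r_small : forall t, 0 < t -> exists k, r k < t.
Hypothesis r_large : forall t (k : int), exists i : nat, t < r (k + i%:Z).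
Implicit Types (x y z : X) (t : R) (P Q : probability (borel X) R) (k : int).

Let mball x k : measurable (ball x (r k) : set (borel X)).
Proof. exact: (measurable_ultraball hultra net). Qed.

Definition step P k x : nat -> R := cond e P (ball x (r (k + 1))) (r k).

(** The selection yields a label, hence the comparison with that of x instead
    of a comparison of balls. *)
Definition stay P k x : set (measurableTypeR R) :=
  [set u | select (@stream R) (step P k x) u = label e (r k) x].

(** All the choices made from level k upwards lead to the ball of x.  The
    intersection is infinite because X may be unbounded, in which case no ball
    contains all the others. *)
Definition located P k x : set T :=
  \bigcap_(i : nat) W (k + i%:Z) @^-1` stay P (k + i%:Z) x.

Lemma mass_function_step P k x : mass_function (step P k x).
Proof. by apply: (mass_function_cond hultra net) => //; exact: mball. Qed.

Lemma measurable_stay P k x : measurable (stay P k x).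
Proof. exact: (measurable_select (iid_stream R)). Qed.

Let mW k A : measurable A -> measurable (W k @^-1` A).
Proof.
move=> mA; rewrite -[X in measurable X]setTI.
by have := (iidW k).1 0%N; rewrite addr0; apply.
Qed.

Lemma measurable_located P k x : measurable (located P k x).
Proof. by apply: bigcapT_measurable => i; apply: mW; exact: measurable_stay. Qed.

Let r_le k l : k <= l -> r k <= r l.
Proof.
move=> kl; have := r_homo k `|l - k|%N; rewrite (_ : k + _ = l)//; lia.
Qed.

Lemma step_eq P k x y : mdist x y < r (k + 1) -> step P k x = step P k y.
Proof. by move=> xy; rewrite /step (ultra_ball_eq hultra xy). Qed.

Lemma stay_eq P k x y : mdist x y < r k -> stay P k x = stay P k y.
Proof.
move=> xy; rewrite /stay (@step_eq P k x y); last first.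
  by apply: lt_le_trans xy _; apply: r_le; rewrite lerDl.
by have /(label_eq hultra net _ _ (r_gt0 k)) -> := xy.
Qed.

Lemma located_eq P k x y : mdist x y < r k -> located P k x = located P k y.
Proof.
by move=> xy; apply: eq_bigcapr => i _; rewrite (@stay_eq P _ x y)//;
  exact: lt_le_trans xy (r_homo _ _).
Qed.

Lemma located_sub P k l x : k <= l -> located P k x `<=` located P l x.
Proof.
move=> kl w h i _; have := h (`|l - k|%N + i)%N Logic.I.
by rewrite (_ : k + _ = l + i%:Z)//; lia.
Qed.

(** Otherwise consider the lowest level at which x and y are in the same ball:
    the choice made there would lead to two different balls. *)
Lemma located_inj P k x y w :
  located P k x w -> located P k y w -> mdist x y < r k.
Proof.
move=> hx hy; apply: contrapT => /negP; rewrite -leNgt => xy.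
have ex : exists i : nat, mdist x y < r (k + i%:Z) by exact: r_large.
have := ex_minnP ex; case: ex_minnP => i hi mini _.
case: i hi mini => [|i] hi mini; first by rewrite addr0 ltNge xy in hi.
have hi' : r (k + i%:Z) <= mdist x y.
  by rewrite leNgt; apply/negP => /mini; rewrite ltnn.
have := hx i Logic.I; have := hy i Logic.I; rewrite /= /stay/=.
rewrite (@step_eq P _ x y); last by rewrite -addrA -PoszD addn1.
move=> -> /(label_eq hultra net _ _ (r_gt0 _)).
by rewrite metric_sym ltNge hi'.
Qed.

Lemma unif_stay P k x : 0 < fine (P (ball x (r (k + 1)))) ->
  unif (stay P k x) =
  (fine (P (ball x (r k))) / fine (P (ball x (r (k + 1)))))%:E.
Proof.
move=> P0; rewrite (select_law (iid_stream R) _ (mass_function_step P k x)).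
congr EFin; rewrite /step /cond gt_eqF//; congr (fine (P _) / _).
rewrite -(ball_block hultra net)//; apply: setIidr => y.
rewrite !ballEmdist /= => /lt_le_trans; apply; by apply: r_le; lia.
Qed.

(** The probabilities of the choices at the levels k, ..., k + N - 1 telescope
    to P (ball x (r k)) / P (ball x (r (k + N))), and denominators are at most
    1. *)
Let located_ge P k x : (P (ball x (r k)) <= mu (located P k x))%E.
Proof.
have := measure_ge0 P (ball x (r k)); rewrite le_eqVlt => /orP[/eqP <-//|P0].
pose m i := fine (P (ball x (r (k + i%:Z)))).
have m_gt0 i : 0 < m i.
  apply: fine_gt0; apply/andP; split.
    apply: (lt_le_trans P0); apply: le_measure; rewrite ?inE; [exact: mball..|].
    by move=> y; rewrite !ballEmdist /= => /lt_le_trans; apply.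
  by rewrite -ge0_fin_numE// fin_num_measure//; exact: mball.
have m_le1 i : m i <= 1.
  by rewrite -lee_fin fineK ?fin_num_measure ?probability_le1//; exact: mball.
pose F N := \bigcap_(i in `I_N) W (k + i%:Z) @^-1` stay P (k + i%:Z) x.
have mF N : measurable (F N).
  by apply: bigcap_measurableType => i _; apply: mW; exact: measurable_stay.
have -> : located P k x = \bigcap_N F N.
  apply/seteqP; split => u h; first by move=> N _ i _; exact: h.
  by move=> i _; apply: (h i.+1 Logic.I) => /=.
have cF : mu \o F @ \oo --> mu (\bigcap_N F N).
  apply: nonincreasing_cvg_mu => //.
  - by rewrite -ge0_fin_numE// fin_num_measure.
  - exact: bigcapT_measurable.
  - move=> a b ab; apply/subsetPset => u h i /= im; apply: h => /=.
    exact: leq_trans im ab.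
rewrite -(cvg_lim _ cF)//; apply: lime_ge; first exact: cvgP cF.
apply: nearW => N /=.
rewrite /F (iidW k).2; last by move=> i; exact: measurable_stay.
have prodE : (\prod_(i < N) unif (stay P (k + i%:Z) x) = (m 0%N / m N)%:E)%E.
  elim: N => [|N IH]; first by rewrite big_ord0 divff// gt_eqF.
  rewrite big_ord_recr/= IH unif_stay; last first.
    by rewrite -addrA -PoszD addn1; exact: m_gt0.
  rewrite -EFinM; congr EFin; rewrite -addrA -PoszD addn1 -/(m N) -/(m N.+1).
  by rewrite mulrA divfK// gt_eqF.
rewrite prodE -[leLHS]fineK; last by rewrite fin_num_measure//; exact: mball.
rewrite lee_fin -[k in leLHS]addr0 -/(m 0%N) ler_pdivlMr// -[leRHS]mulr1.
by rewrite ler_wpM2l// ltW.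
Qed.

(** Balls of radius r k are named by labels; a number that is not the label of
    a ball gets the empty event. *)
Let loc P k n : set T :=
  if label e (r k) (e n) == n then located P k (e n) else set0.

Let measurable_loc P k n : measurable (loc P k n).
Proof. by rewrite /loc; case: ifP => // _; exact: measurable_located. Qed.

Let trivIset_loc P k : trivIset setT (loc P k).
Proof.
apply/trivIsetP => i j _ _ ij; rewrite -subset0 /loc => w [].
case: eqP => // ei hi; case: eqP => // ej hj.
have := located_inj hi hj => /(label_eq hultra net _ _ (r_gt0 k)).
by rewrite ei ej => /eqP; rewrite (negbTE ij).
Qed.

Let block_loc P k n : (P (block e (r k) n) <= mu (loc P k n))%E.
Proof.
rewrite /loc; case: eqP => [en|en].
  by rewrite -{1}en -(ball_block hultra net)//; exact: located_ge.
rewrite (_ : block _ _ _ = set0) ?measure0// -subset0 => x xn; apply: en.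
exact: (block_center hultra net (r_gt0 k) xn).
Qed.

Let loc_law P k n : mu (loc P k n) = P (block e (r k) n).
Proof.
apply: (@mass_squeeze _ (fun n => mu (loc P k n)) (fun n => P (block e (r k) n))) => //.
- rewrite -measure_semi_bigcup//; first by apply: probability_le1; exact: bigcupT_measurable.
  exact: bigcupT_measurable.
- rewrite -[RHS](@probability_setT _ _ _ P) -(sum_block hultra net P (r_gt0 k) measurableT).
  by apply: eq_eseriesr => m _; rewrite setTI.
Qed.

(** The located events of level k are disjoint and each has at least the
    probability of its ball; as the balls have total mass 1, these bounds are
    equalities. *)
Lemma located_law P k x : mu (located P k x) = P (ball x (r k)).
Proof.
have xk : mdist x (e (label e (r k) x)) < r k.
  by rewrite metric_sym; exact: (label_dist net).
rewrite (ball_block hultra net)// -loc_law /loc.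
have -> : label e (r k) (e (label e (r k) x)) = label e (r k) x.
  by apply/(label_eq hultra net _ _ (r_gt0 k)); exact: (label_dist net).
by rewrite eqxx (located_eq P xk).
Qed.

(** An event of full probability, on which the selected balls form a chain
    that determines a point. *)
Definition good P : set T := \bigcap_k \bigcup_n located P k (e n).

Lemma measurable_good P : measurable (good P).
Proof.
rewrite /good -[X in measurable X]setCK setC_bigcap; apply: measurableC.
apply: countable_bigcupT_measurable => // k; apply: measurableC.
by apply: bigcupT_measurable => n; exact: measurable_located.
Qed.

Lemma good_ae P : mu (~` good P) = 0%E.
Proof.
rewrite /good setC_bigcap.
have full k : mu (~` \bigcup_n located P k (e n)) = 0%E.
  have mU : measurable (\bigcup_n located P k (e n)).
    by apply: bigcupT_measurable => n; exact: measurable_located.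
  rewrite probability_setC//.
  suff -> : mu (\bigcup_n located P k (e n)) = 1%E by rewrite subee.
  apply/eqP; rewrite eq_le probability_le1//=.
  apply: (@le_trans _ _ (\sum_(n <oo) mu (loc P k n))%E).
    under eq_eseriesr do rewrite loc_law.
    rewrite -(@probability_setT _ _ _ P).
    rewrite -(sum_block hultra net P (r_gt0 k) measurableT).
    by under eq_eseriesr do rewrite setTI.
  rewrite -measure_semi_bigcup//; last exact: bigcupT_measurable.
  apply: le_measure; rewrite ?inE//.
    by apply: bigcupT_measurable => n; exact: measurable_loc.
  by apply: subset_bigcup => n _ w; rewrite /loc; case: ifP.
rewrite (_ : \bigcup_k _ = \bigcup_n
    ~` \bigcup_m located P (odflt 0 (unpickle n)) (e m)); last first.
  apply/seteqP; split => w [k _ hk].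
    by exists (pickle k) => //; rewrite pickleK.
  by exists (odflt 0 (unpickle k)).
apply/negligibleP.
  apply: bigcupT_measurable => n; apply: measurableC.
  by apply: bigcupT_measurable => m; exact: measurable_located.
apply: negligible_bigcup => n; apply/negligibleP; last exact: full.
apply: measurableC.
by apply: bigcupT_measurable => m; exact: measurable_located.
Qed.

Lemma good_ae_eq P E : measurable E -> mu E = mu (E `&` good P).
Proof.
move=> mE; have mg := measurable_good P.
rewrite -[in LHS](setIT E) -(setUv (good P)) setIUr measureU/=.
- rewrite [X in (_ + X)%E](_ : _ = 0%E) ?adde0//.
  apply/eqP; rewrite eq_le measure_ge0 andbT -(good_ae P).
  apply: le_measure; rewrite ?inE; last exact: subIsetr.
    by apply: measurableI => //; exact: measurableC.
  exact: measurableC.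
- exact: measurableI.
- by apply: measurableI => //; exact: measurableC.
- by rewrite setIACA setICr setI0.
Qed.

(** Off the event [good] the set is empty, and the sample is the default
    point. *)
Definition sample P (w : T) : X :=
  xget point [set x | forall k, W k w \in stay P k x].

Lemma located_all P x w : (forall k, W k w \in stay P k x) <->
  forall k, located P k x w.
Proof.
split => [h k i _|h k]; first by have := h (k + i%:Z); rewrite inE.
by rewrite inE; have := h k 0%N Logic.I; rewrite /= addr0.
Qed.

Lemma good_located P w : (exists x, forall k, located P k x w) -> good P w.
Proof.
move=> [x hx] k _; exists (label e (r k) x) => //.
rewrite -(@located_eq P k x)//; rewrite metric_sym; exact: (label_dist net).
Qed.

(** Points in the selected balls of smaller and smaller radii form a Cauchy
    sequence, whose limit lies in all these balls. *)
Lemma sample_located P k w : good P w -> located P k (sample P w) w.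
Proof.
move=> gw; suff : [set x | forall k, W k w \in stay P k x] !=set0.
  move=> [x hx]; rewrite /sample; case: xgetP => [y _ /located_all|/(_ x)//].
  by move=> /(_ k).
have /choice[f hf] : forall k, exists x, located P k x w.
  by move=> l; have [n _ h] := gw l Logic.I; exists (e n).
have close k1 k2 : k1 <= k2 -> mdist (f k1) (f k2) < r k2.
  by move=> k12; apply: (located_inj (located_sub k12 (hf k1))).
pose u (n : nat) := f (- n%:Z).
have small t : 0 < t -> exists n : nat, r (- n%:Z) < t.
  move=> t0; have [l lt] := r_small t0; exists `|l|%N; apply: le_lt_trans lt.
  by apply: r_le; lia.
have cu : cvg (u @ \oo).
  apply/cauchy_cvgP/cauchy_exP => t t0; have [n nt] := small t t0.
  exists (u n); exists n => // m /= nm; rewrite ballEmdist /=.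
  apply: lt_trans nt; rewrite metric_sym; apply: close; lia.
exists (limn u); apply/located_all => l.
rewrite (@located_eq P l _ (f l))//.
have := cu => /cvg_ballP/(_ (r l) (r_gt0 l))[N _ hN].
have [n ln] : exists n : nat, - n%:Z <= l by exists `|l|%N; lia.
have := hN (maxn N n) (leq_maxl _ _); rewrite ballEmdist /= => h1.
apply: (ultra_lt hultra h1); apply: close; lia.
Qed.

Lemma sample_ball P k x w : good P w ->
  ball x (r k) (sample P w) <-> located P k x w.
Proof.
move=> gw; have hs := sample_located k gw; split => [xs|hx].
  by rewrite (@located_eq P k x (sample P w))//; rewrite ballEmdist in xs.
by rewrite ballEmdist; exact: located_inj hx hs.
Qed.

Lemma sample_bad P w : ~ good P w -> sample P w = point.
Proof.
move=> bw; rewrite /sample; case: xgetP => // x _ hx; exfalso; apply: bw.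
by apply: good_located; exists x; exact/located_all.
Qed.

(** An open set is a union of balls around the net, of which there are
    countably many. *)
Lemma measurable_sample P : measurable_fun setT (sample P : T -> borel X).
Proof.
apply: (@measurability _ _ T (borel X) setT (sample P) (@open X)) => //.
move=> _ [U oU <-]; rewrite setTI.
pose F (p : int * nat) : set T :=
  if `[< ball (e p.2) (r p.1) `<=` U >] then located P p.1 (e p.2) else set0.
have -> : sample P @^-1` U = (good P `&` \bigcup_p F p) `|`
    (if `[< U point >] then ~` good P else set0).
  apply/seteqP; split => w /=.
    move=> wU; have [gw|bw] := pselect (good P w); [left|right]; last first.
      by rewrite (sample_bad bw) in wU; case: asboolP.
    split=> //; move: oU; rewrite openE => /(_ _ wU)/nbhs_ballP[t /= t0 tU].
    have [k kt] := r_small t0.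
    set n := label e (r k) (sample P w).
    have en : mdist (e n) (sample P w) < r k by exact: (label_dist net).
    have sub : ball (e n) (r k) `<=` U.
      apply: subset_trans tU.
      rewrite (ultra_ball_eq hultra en) => y; rewrite !ballEmdist /= => h.
      exact: lt_trans h kt.
    exists (k, n) => //; rewrite /F /=; case: asboolP => // ?.
    by apply/(sample_ball k (e n) gw); rewrite ballEmdist.
  move=> [[gw [[k n] _]]|].
    by rewrite /F; case: asboolP => //= sU /(sample_ball k (e n) gw) h; exact: sU.
  by case: asboolP => // Up bw; rewrite (sample_bad bw).
apply: measurableU.
  apply: measurableI; first exact: measurable_good.
  apply: countable_bigcupT_measurable => // p; rewrite /F.
  by case: asboolP => // ?; exact: measurable_located.
by case: asboolP => // ?; apply: measurableC; exact: measurable_good.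
Qed.

Lemma open_ultraballs (U : set X) : open U ->
  <<s [set A | A = set0 \/ exists x k, A = ball x (r k)] >> U.
Proof.
move=> oU; set G := [set A | _].
pose F (p : int * nat) : set (g_sigma_algebraType G) :=
  if `[< ball (e p.2) (r p.1) `<=` U >] then ball (e p.2) (r p.1) else set0.
have -> : U = \bigcup_p F p.
  apply/seteqP; split => x; last first.
    by move=> [p _]; rewrite /F; case: asboolP => // h; exact: h.
  move=> Ux; move: oU; rewrite openE => /(_ _ Ux)/nbhs_ballP[t /= t0 tU].
  have [k kt] := r_small t0; set n := label e (r k) x.
  have en : mdist (e n) x < r k by exact: (label_dist net).
  have sub : ball (e n) (r k) `<=` U.
    apply: subset_trans tU.
    rewrite (ultra_ball_eq hultra en) => y; rewrite !ballEmdist /= => h.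
    exact: lt_trans h kt.
  by exists (k, n) => //; rewrite /F /=; case: asboolP => // ?; rewrite ballEmdist.
suff : measurable (\bigcup_p F p) by [].
apply: countable_bigcupT_measurable => // p; rewrite /F; case: asboolP => // ?.
by apply: sub_sigma_algebra; right; exists (e p.2), (p.1).
Qed.

(** Two balls are nested or disjoint, so that balls form a system stable under
    intersection, and they generate the Borel sets by separability. *)
Lemma sample_law P (A : set (borel X)) : measurable A ->
  mu (sample P @^-1` A) = P A.
Proof.
move=> mA; pose G : set (set (borel X)) :=
  [set A | A = set0 \/ exists x k, A = ball x (r k)].
have := @law_indep R _ _ T (borel X) mu P (sample P) setT G.
rewrite probability_setT => H; have := H _ _ (measurable_sample P) measurableT _ A mA.
rewrite setIT mule1; apply.
- apply/seteqP; split => B mB.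
    exact: (@smallest_sub _ (sigma_algebra setT) (@open X) <<s G>>
      (smallest_sigma_algebra setT G) open_ultraballs B mB).
  apply: (@smallest_sub _ (sigma_algebra setT) G (@measurable _ (borel X))
    (sigma_algebra_measurable _) _ B mB).
  by move=> _ [->|[x [k ->]]]; [exact: measurable0|exact: mball].
- have sub k l x y : k <= l -> ball x (r k) `&` ball y (r l) = set0 \/
      ball x (r k) `&` ball y (r l) = ball x (r k).
    move=> kl; have [h|h] := pselect (mdist x y < r l); [right|left].
      apply: setIidl; rewrite -(ultra_ball_eq hultra h) => z.
      by rewrite !ballEmdist /= => /lt_le_trans; apply; exact: r_le.
    rewrite -subset0 => z; rewrite !ballEmdist /= => -[xz yz]; apply: h.
    apply: (ultra_lt hultra (lt_le_trans xz (r_le kl))).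
    by rewrite metric_sym.
  move=> B C [->|[x [k ->]]]; first by left; rewrite set0I.
  move=> [->|[y [l ->]]]; first by left; rewrite setI0.
  have [kl|lk] := leP k l.
    by have [->|->] := sub k l x y kl; [left|right; exists x, k].
  by rewrite setIC; have [->|->] := sub l k y x (ltW lk); [left|right; exists y, l].
- move=> B [->|[x [k ->]]]; first by rewrite preimage_set0 set0I !measure0 mul0e.
  rewrite setIT mule1.
  have ms : measurable (sample P @^-1` ball x (r k)).
    by rewrite -[X in measurable X]setTI; apply: measurable_sample => //; exact: mball.
  rewrite -(located_law P k x).
  rewrite (good_ae_eq P)// [RHS](good_ae_eq P); last exact: measurable_located.
  congr (mu _); apply/seteqP; split => w [h gw]; split => //.
    exact/(sample_ball k x gw).
  exact/(sample_ball k x gw).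
Qed.

(** Both samples descend to the same ball of level k + 1, where the choices
    of the next ball differ. *)
Let jump P Q k n : set T :=
  if label e (r (k + 1)) (e n) == n then
    (located P (k + 1) (e n) `&` located Q (k + 1) (e n)) `&`
    W k @^-1` [set u | select (@stream R) (step P k (e n)) u <>
                       select (@stream R) (step Q k (e n)) u]
  else set0.

Let measurable_neq P Q k n :
  measurable [set u | select (@stream R) (step P k (e n)) u <>
                      select (@stream R) (step Q k (e n)) u].
Proof.
have ms := measurable_select (iid_stream R).
rewrite (_ : mkset _ = ~` [set u | select (@stream R) (step P k (e n)) u =
                                  select (@stream R) (step Q k (e n)) u])//.
apply: measurableC; rewrite (_ : mkset _ = \bigcup_j
    ([set u | select (@stream R) (step P k (e n)) u = j] `&`
     [set u | select (@stream R) (step Q k (e n)) u = j])).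
  by apply: bigcupT_measurable => j; apply: measurableI; exact: ms.
apply/seteqP; split => u /=; last by move=> [j _ [/= -> ->]].
by move=> eq; exists (select (@stream R) (step P k (e n)) u).
Qed.

Let measurable_jump P Q k n : measurable (jump P Q k n).
Proof.
rewrite /jump; case: ifP => // _; apply: measurableI.
  by apply: measurableI; exact: measurable_located.
by apply: mW; exact: measurable_neq.
Qed.

Let trivIset_jump P Q k : trivIset setT (jump P Q k).
Proof.
apply/trivIsetP => i j _ _ ij; rewrite -subset0 /jump => w [].
case: eqP => // ei [[hi _] _]; case: eqP => // ej [[hj _] _].
have := located_inj hi hj => /(label_eq hultra net _ _ (r_gt0 _)).
by rewrite ei ej => /eqP; rewrite (negbTE ij).
Qed.

Let jump_indep P (S : set (measurableTypeR R)) k x : measurable S ->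
  mu (W k @^-1` S `&` located P (k + 1) x) = (unif S * P (ball x (r (k + 1))))%E.
Proof.
move=> mS; rewrite -located_law.
have := @iid_tail_indep _ _ _ mu (fun i => W (k + i%:Z)) S
  (fun i => stay P (k + 1 + i%:Z) x) (iidW k) mS.
rewrite addr0 /located.
have -> : \bigcap_i W (k + i.+1%:Z) @^-1` stay P (k + 1 + i%:Z) x =
    \bigcap_i W (k + 1 + i%:Z) @^-1` stay P (k + 1 + i%:Z) x.
  by apply: eq_bigcapr => i _; rewrite -addrA -PoszD add1n.
by apply => i; exact: measurable_stay.
Qed.

(** The choice made inside a ball is independent of the choices that lead to
    it.  Hence the event has probability at most P B, and at most Q B, times the
    probability that the two selections differ, B being the ball concerned. *)
Let jump_le P Q k n :
  (mu (jump P Q k n) <=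
   \sum_(j <oo) `|fine (P (block e (r (k + 1)) n `&` block e (r k) j))
                 - fine (Q (block e (r (k + 1)) n `&` block e (r k) j))|%:E
   + `|mass e P (r (k + 1)) n - mass e Q (r (k + 1)) n|%:E)%E.
Proof.
rewrite /jump; case: eqP => en; last by rewrite measure0 adde_ge0// nneseries_ge0.
have bE : ball (e n) (r (k + 1)) = block e (r (k + 1)) n.
  by rewrite (ball_block hultra net)// en.
rewrite /mass -bE.
apply: le_trans (cond_bound hultra net P Q (r_gt0 k) (mball (e n) (k + 1))).
set S := [set u | _ <> _].
have mS : measurable S by exact: measurable_neq.
have US : (unif S <= l1dist (step P k (e n)) (step Q k (e n)))%E.
  apply: (select_coupling (iid_stream R)); exact: mass_function_step.
have bound P' : located P (k + 1) (e n) `&` located Q (k + 1) (e n) `<=`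
      located P' (k + 1) (e n) ->
    (mu ((located P (k + 1) (e n) `&` located Q (k + 1) (e n)) `&` W k @^-1` S) <=
     P' (ball (e n) (r (k + 1))) * l1dist (step P k (e n)) (step Q k (e n)))%E.
  move=> sub; apply: (@le_trans _ _ (mu (W k @^-1` S `&` located P' (k + 1) (e n)))).
    apply: le_measure; rewrite ?inE.
    - apply: measurableI; last exact: mW.
      by apply: measurableI; exact: measurable_located.
    - by apply: measurableI; [exact: mW|exact: measurable_located].
    - by rewrite setIC; apply: setIS.
  by rewrite jump_indep// muleC lee_wpmul2l.
by case: (leP (P _) (Q _)) => _; apply: bound; [exact: subIsetl|exact: subIsetr].
Qed.

(** Samples at such a distance lie in the same ball of level k + 1 but in
    different balls of level k. *)
Lemma sample_split P Q k :
  (mu [set w | r k <= mdist (sample P w) (sample Q w) < r (k + 1)]%R <=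
   l1dist (mass e P (r k)) (mass e Q (r k)) +
   l1dist (mass e P (r (k + 1))) (mass e Q (r (k + 1))))%E.
Proof.
set E := [set w | _].
have mE : measurable E.
  have lt t : 0 < t -> measurable [set w | mdist (sample P w) (sample Q w) < t].
    move=> t0; rewrite -[X in measurable X]setTI.
    by apply: (measurable_dist_lt hultra net) => //; exact: measurable_sample.
  rewrite (_ : E = [set w | mdist (sample P w) (sample Q w) < r (k + 1)] `\`
                   [set w | mdist (sample P w) (sample Q w) < r k]).
    by apply: measurableD; exact: lt.
  apply/seteqP; split => w; rewrite /E /=.
    by move=> /andP[lo up]; split=> //; apply/negP; rewrite -leNgt.
  by move=> [up /negP]; rewrite -leNgt => lo; rewrite lo up.
rewrite (good_ae_eq P)// (good_ae_eq Q); last first.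
  by apply: measurableI => //; exact: measurable_good.
apply: (@le_trans _ _ (\sum_(n <oo) mu (jump P Q k n))%E).
  rewrite -measure_semi_bigcup//; last exact: bigcupT_measurable.
  apply: le_measure; rewrite ?inE.
  - by apply: measurableI; [apply: measurableI => //|]; exact: measurable_good.
  - exact: bigcupT_measurable.
  - move=> w [[/andP[lo up] gP] gQ].
    set y := sample P w in lo up *; set n := label e (r (k + 1)) y.
    have yn : mdist y (e n) < r (k + 1).
      by rewrite metric_sym; exact: (label_dist net).
    have zn : mdist (sample Q w) (e n) < r (k + 1).
      by apply: (ultra_lt hultra) yn; rewrite metric_sym.
    exists n => //; rewrite /jump.
    have -> : label e (r (k + 1)) (e n) = n.
      by apply/(label_eq hultra net) => //; exact: (label_dist net).
    rewrite eqxx; split; first split.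
    + by rewrite -(located_eq P yn); exact: sample_located.
    + by rewrite -(located_eq Q zn); exact: sample_located.
    rewrite /= -(step_eq P yn) -(step_eq Q zn).
    have hP := sample_located k gP; have hQ := sample_located k gQ.
    have := hP 0%N Logic.I; have := hQ 0%N Logic.I.
    rewrite /= !addr0 /stay /= => -> -> /(label_eq hultra net _ _ (r_gt0 k)).
    by rewrite ltNge lo.
apply: (@le_trans _ _ (\sum_(n <oo)
   (\sum_(j <oo) `|fine (P (block e (r (k + 1)) n `&` block e (r k) j))
                 - fine (Q (block e (r (k + 1)) n `&` block e (r k) j))|%:E
   + `|mass e P (r (k + 1)) n - mass e Q (r (k + 1)) n|%:E))%E).
  by apply: lee_nneseries => // n _; exact: jump_le.
rewrite nneseriesD//; last by move=> n _ _; rewrite nneseries_ge0.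
rewrite (sum_refine hultra net)//.
by apply: r_le; lia.
Qed.

End tree.

(** * Layered integrals and sums over the integers *)

Section layers.
Local Open Scope ereal_scope.
Context d (T : measurableType d) (R : realType) (mu : {measure set T -> \bar R}).

Lemma layer_integral (D : set T) (a : nat -> R) (F : nat -> set T) :
  measurable D -> (forall n, (0 <= a n)%R) -> (forall n, measurable (F n)) ->
  \int[mu]_(x in D) (\sum_(n <oo) (a n * \1_(F n) x)%:E) =
  \sum_(n <oo) (a n)%:E * mu (F n `&` D).
Proof.
move=> mD a0 mF; rewrite integral_nneseries//.
- apply: eq_eseriesr => n _; under eq_integral do rewrite EFinM.
  rewrite ge0_integralZl ?lee_fin//.
  + by rewrite integral_indic.
  + by apply/measurable_EFinP; exact: measurable_indic.
- move=> n; apply/measurable_EFinP.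
  by apply: measurable_funM; [exact: measurable_cst|exact: measurable_indic].
- by move=> n x _; rewrite lee_fin mulr_ge0.
Qed.

Lemma measurable_layers (D : set T) (a : nat -> R) (F : nat -> set T) :
  measurable D -> (forall n, (0 <= a n)%R) -> (forall n, measurable (F n)) ->
  measurable_fun D (fun x => \sum_(n <oo) (a n * \1_(F n) x)%:E).
Proof.
move=> mD a0 mF; apply: ge0_emeasurable_sum.
- by move=> n x _ _; rewrite lee_fin mulr_ge0.
- move=> n _; apply/measurable_EFinP.
  by apply: measurable_funM; [exact: measurable_cst|exact: measurable_indic].
Qed.

Lemma integral_le_layers (D : set T) (a : nat -> R) (F : nat -> set T)
    (f : T -> \bar R) :
  measurable D -> (forall n, (0 <= a n)%R) -> (forall n, measurable (F n)) ->
  (forall x, D x -> 0 <= f x) -> measurable_fun D f ->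
  (forall x, D x -> f x <= \sum_(n <oo) (a n * \1_(F n) x)%:E) ->
  \int[mu]_(x in D) f x <= \sum_(n <oo) (a n)%:E * mu (F n `&` D).
Proof.
move=> mD a0 mF f0 mf hf; rewrite -layer_integral//.
apply: ge0_le_integral => //; exact: measurable_layers.
Qed.

Lemma layers_le_integral (D : set T) (a : nat -> R) (F : nat -> set T)
    (f : T -> \bar R) :
  measurable D -> (forall n, (0 <= a n)%R) -> (forall n, measurable (F n)) ->
  measurable_fun D f ->
  (forall x, D x -> \sum_(n <oo) (a n * \1_(F n) x)%:E <= f x) ->
  \sum_(n <oo) (a n)%:E * mu (F n `&` D) <= \int[mu]_(x in D) f x.
Proof.
move=> mD a0 mF mf hf; rewrite -layer_integral//.
apply: ge0_le_integral => //; last exact: measurable_layers.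
by move=> x Dx; apply: nneseries_ge0 => n _ _; rewrite lee_fin mulr_ge0.
Qed.

End layers.

Section lebesgue.
Variable R : realType.
Notation caraR := (caratheodory_type (wlength (@idfun R))^*%mu).

Lemma cara_borel (A : set (measurableTypeR R)) :
  measurable A -> measurable (A : set caraR).
Proof. exact: sub_caratheodory. Qed.

Lemma leb_unif (A : set (measurableTypeR R)) : measurable A ->
  leb R (`[0%R, 1%R] `&` A) = unif A.
Proof.
move=> mA; rewrite /unif /mrestr.
transitivity (lebesgue_measure ((A `&` `[0%R, 1%R[) `|` (A `&` [set 1%R]))).
  transitivity (lebesgue_measure (`[0%R, 1%R] `&` A)); first by [].
  congr lebesgue_measure; apply/seteqP; split => x.
    move=> [/=]; rewrite in_itv/= [x <= 1]le_eqVlt => /andP[x0 /orP[/eqP->|x1]] Ax.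
      by right.
    by left; split=> //=; rewrite in_itv/= x0.
  move=> [[Ax]|[Ax e]]; rewrite /= !in_itv/=.
    by move=> /andP[x0 /ltW x1]; split=> //; rewrite x0.
  by rewrite e in Ax *; split=> //; apply/andP.
rewrite measureU/=.
- rewrite [X in (_ + X)%E](_ : _ = 0%E) ?adde0//.
  apply/eqP; rewrite eq_le measure_ge0 andbT -(lebesgue_measure_set1 (1:R)).
  apply: le_measure; rewrite ?inE.
  + by apply: measurableI => //; exact: measurable_set1.
  + exact: measurable_set1.
  + exact: subIsetr.
- by apply: measurableI => //; exact: measurable_itv.
- by apply: measurableI => //; exact: measurable_set1.
- rewrite -subset0 => x [[_]]; rewrite /= in_itv/= => /andP[_ x1] [_ e].
  by rewrite e ltxx in x1.
Qed.

End lebesgue.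

(** An explicit enumeration of the integers, by which sums over all the radii
    become series. *)
Definition zigzag (n : nat) : int := if odd n then Negz n./2 else Posz n./2.

Lemma zigzag_bij : set_bij setT setT zigzag.
Proof.
split=> //.
- move=> m n _ _; rewrite /zigzag; case: (boolP (odd m)); case: (boolP (odd n)) => //.
    by move=> on om [h]; rewrite -[m]odd_double_half -[n]odd_double_half on om h.
  move=> /negbTE on /negbTE om [h].
  by rewrite -[m]odd_double_half -[n]odd_double_half on om h.
- move=> [n|n] _ /=; [exists n.*2 => //|exists n.*2.+1 => //]; rewrite /zigzag.
    by rewrite odd_double doubleK.
  by rewrite /= odd_double/= uphalf_double.
Qed.

Section integer_sums.
Variable R : realType.
Local Open Scope ereal_scope.

Lemma zigzag_esum (a : int -> \bar R) : (forall j, 0 <= a j) ->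
  \sum_(n <oo) a (zigzag n) = \esum_(j in setT) a j.
Proof.
by move=> a0; rewrite nneseries_esumT// (@reindex_esum _ _ _ _ _ _ a zigzag_bij).
Qed.

Lemma zigzag_shift (a : int -> \bar R) (l : int) : (forall j, 0 <= a j) ->
  \sum_(n <oo) a (zigzag n + l)%R = \sum_(n <oo) a (zigzag n).
Proof.
move=> a0; rewrite (zigzag_esum (a := fun j => a (j + l)%R))// zigzag_esum//.
rewrite [RHS](@reindex_esum _ int int setT setT (fun j => j + l)%R)//.
split=> // [m n _ _ /addIr//|m _]; exists (m - l)%R => //.
by rewrite subrK.
Qed.

Lemma zigzag_telescope (g : int -> R) (K : nat) :
  (\sum_(n < K.*2) (g (zigzag n) - g (zigzag n - 1)) =
  g (K%:Z - 1) - g (- K%:Z - 1))%R.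
Proof.
elim: K => [|K IH]; first by rewrite big_ord0; exact/esym/subrr.
rewrite doubleS !big_ord_recr/= IH /zigzag /= odd_double/= doubleK uphalf_double.
rewrite NegzE; have -> : (K.+1%:Z - 1 = K%:Z)%R by lia.
have -> : (- K%:Z - 1 = - K.+1%:Z)%R by lia.
lra.
Qed.

End integer_sums.

(** * The sampler with a random shift of the radii *)

Section scales.
Variable R : realType.

(** For a growth factor s and a period M the method gives the ratio
    2 (1 + s ^ M) / (M (1 - 1 / s)).  When s tends to 1 with s ^ M fixed to h,
    it tends to 2 (1 + h) / ln h, whose minimum is about 7.18; the values 11 / 10
    and 13 are simple and reach 7.535. *)
Definition growth : R := 11%:R / 10%:R.
Definition period : nat := 13.
Definition scale (j : int) : R := growth ^ j.
Definition radius (m : nat) (k : int) : R := scale (m%:Z + period%:Z * k).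

Lemma growth_gt0 : 0 < growth. Proof. by rewrite divr_gt0. Qed.

Lemma growth_gt1 : 1 < growth. Proof. by rewrite /growth; lra. Qed.

Lemma scale_gt0 j : 0 < scale j. Proof. by rewrite exprz_gt0// growth_gt0. Qed.

Lemma scaleD i j : scale (i + j) = scale i * scale j.
Proof. by rewrite /scale expfzDr// gt_eqF// growth_gt0. Qed.

Lemma scale_ge1 (i : nat) : 1 + i%:R / 10%:R <= scale i%:Z.
Proof.
elim: i => [|i IH]; first by rewrite mul0r addr0 /scale expr0z.
rewrite -addn1 PoszD scaleD /scale expr1z -/(scale i%:Z) natrD.
have : 0 <= i%:R / 10%:R :> R by rewrite divr_ge0.
by move: IH; rewrite /growth; lra.
Qed.

Lemma scale_homo (j : int) (i : nat) : scale j <= scale (j + i%:Z).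
Proof.
rewrite scaleD ler_peMr//; first exact/ltW/scale_gt0.
by apply: le_trans (scale_ge1 i); rewrite lerDl divr_ge0.
Qed.

Lemma scale_large (t : R) (j : int) : exists i : nat, t < scale (j + i%:Z).
Proof.
have j0 := scale_gt0 j.
exists (Num.truncn (10%:R * t / scale j)).+1; set i := _.+1.
rewrite scaleD mulrC -ltr_pdivrMr//; apply: lt_le_trans (scale_ge1 i).
have : 10%:R * t / scale j < i%:R by exact: truncnS_gt.
by rewrite -mulrA; lra.
Qed.

Lemma scale_small (t : R) : 0 < t -> exists i : nat, scale (- i%:Z) < t.
Proof.
move=> t0; have [i] := scale_large t^-1 0; rewrite add0r => h; exists i.
rewrite /scale -invr_expz -[ltRHS]invrK ltf_pV2 ?posrE ?invr_gt0//.
exact: (scale_gt0 i%:Z).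
Qed.

Lemma radius_gt0 m k : 0 < radius m k. Proof. exact: scale_gt0. Qed.

Lemma radius_homo m k (i : nat) : radius m k <= radius m (k + i%:Z).
Proof.
rewrite /radius mulrDr addrA -[period%:Z * i%:Z]/((period * i)%N%:Z).
exact: scale_homo.
Qed.

Lemma radius_large m (t : R) (k : int) : exists i : nat, t < radius m (k + i%:Z).
Proof.
have [i ti] := scale_large t (m%:Z + period%:Z * k); exists i.
apply: lt_le_trans ti _; rewrite /radius mulrDr addrA.
have -> : m%:Z + period%:Z * k + period%:Z * i%:Z =
    m%:Z + period%:Z * k + i%:Z + (12 * i)%N%:Z.
  by rewrite /period; lia.
exact: scale_homo.
Qed.

Lemma radius_small m (t : R) : 0 < t -> exists k, radius m k < t.
Proof.
move=> t0; have [i it] := scale_small t0; exists (- (m + i)%N%:Z).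
apply: le_lt_trans it; rewrite /radius.
have -> : - i%:Z = m%:Z + period%:Z * - (m + i)%N%:Z + (12 * m + 12 * i)%N%:Z.
  by rewrite /period; lia.
exact: scale_homo.
Qed.

Lemma radius_bracket m (t : R) : 0 < t ->
  exists k, radius m k <= t < radius m (k + 1).
Proof.
move=> t0; have [k kt] := radius_small m t0.
have ex := radius_large m t k.
case: (ex_minnP ex) => -[|i] ti mini.
  by move: ti; rewrite addr0 ltNge ltW.
exists (k + i%:Z); rewrite -addrA -PoszD addn1 ti andbT leNgt.
by apply/negP => /mini; rewrite ltnn.
Qed.

Lemma radius_scale (j : int) :
  radius `|(j %% period)%Z|%N (j %/ period)%Z = scale j.
Proof.
rewrite /radius gez0_abs ?modz_ge0//; congr scale.
by rewrite [RHS](divz_eq j period) mulrC addrC.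
Qed.

Lemma radius_scaleS (j : int) :
  radius `|(j %% period)%Z|%N ((j %/ period)%Z + 1) = scale (j + period%:Z).
Proof.
rewrite /radius gez0_abs ?modz_ge0//; congr scale.
by rewrite [in RHS](divz_eq j period); ring.
Qed.

(** A uniform shift when v is uniform.  The remainder changes nothing for v in
    [0, 1[, and makes the shift smaller than the period for all v. *)
Definition shift (v : R) : nat := (Num.truncn (period%:R * v) %% period)%N.

Lemma shift_lt v : (shift v < period)%N. Proof. exact: ltn_pmod. Qed.

Lemma measurable_shift m : measurable [set v : measurableTypeR R | shift v = m].
Proof.
have p0 : 0 < period%:R :> R by [].
rewrite -[X in measurable X]setTI.
exact: (measurable_truncn_scale p0 measurableT (_ : measurable
  [set i : nat | (i %% period)%N = m])).
Qed.

Lemma unif_shift m : (m < period)%N ->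
  unif [set v : R | shift v = m] = (period%:R^-1)%:E.
Proof.
move=> mp; have p0 : 0 < period%:R :> R by [].
transitivity (unif `[m%:R / period%:R : R, m.+1%:R / period%:R[%classic : \bar R).
  rewrite /unif /mrestr; congr (lebesgue_measure _); apply/seteqP; split => x.
    move=> [/= sx x01]; split=> //; move: x01; rewrite /= !in_itv/= => /andP[x0 x1].
    rewrite ler_pdivrMr// ltr_pdivlMr// ![x * _]mulrC.
    have px0 : 0 <= period%:R * x by rewrite mulr_ge0.
    rewrite -sx /shift modn_small ?truncn_itv// truncn_lt_nat//.
    by rewrite -[ltRHS]mulr1 ltr_pM2l.
  move=> [xm x01]; split=> //; move: xm; rewrite /= in_itv/=.
  rewrite ler_pdivrMr// ltr_pdivlMr// ![x * _]mulrC => /truncn_def h.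
  by rewrite /shift h modn_small.
rewrite unif_itv_co.
- by rewrite -mulrBl -natr1 [_ + 1]addrC addrK mul1r.
- by rewrite divr_ge0// ltW.
- by rewrite ler_pM2r ?invr_gt0// ler_nat.
- by rewrite ler_pdivrMr// mul1r ler_nat.
Qed.

Definition level_stream (k : int) := @stream R (pickle k).

Lemma iid_level_stream (k : int) :
  iid_uniform (@unif R) (fun i : nat => level_stream (k + i%:Z)).
Proof.
apply: (@iid_reindex _ _ _ _ (@stream R) (fun i : nat => pickle (k + i%:Z))).
  by move=> i j /(pcan_inj pickleK)/addrI[].
exact: iid_stream.
Qed.

End scales.

Section mixture.
Variables (R : realType) (X : completeMetricType R) (e : nat -> X).
Hypothesis hultra : ultrametric (@mdist R X).
Hypothesis net : forall x t, 0 < t -> exists n, mdist (e n) x < t.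
Implicit Types (x y z : X) (t : R) (P Q : probability (borel X) R).

Definition shifted (m : nat) P : measurableTypeR R -> X :=
  sample e (@level_stream R) (radius R m) P.

(** One half of the digits of w determines the shift and the other half the
    sample, so that they are independent. *)
Definition mixture P : R -> X :=
  fun w => shifted (shift (fst_half w)) P (snd_half w).

Let measurable_shifted m P :
  measurable_fun setT (shifted m P : measurableTypeR R -> borel X).
Proof.
apply: (measurable_sample hultra net (@iid_level_stream R)).
- exact: radius_gt0.
- exact: radius_homo.
- exact: radius_small.
- exact: radius_large.
Qed.

Let shifted_law m P (A : set (borel X)) : measurable A ->
  unif (shifted m P @^-1` A) = P A.
Proof.
apply: (sample_law hultra net (@iid_level_stream R)).
- exact: radius_gt0.
- exact: radius_homo.
- exact: radius_small.
- exact: radius_large.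
Qed.

Let mixtureE P (A : set X) : mixture P @^-1` A = \bigcup_m
  (@fst_half R @^-1` [set v | shift v = m] `&`
   @snd_half R @^-1` (shifted m P @^-1` A)).
Proof.
apply/seteqP; split => w; last by move=> [m _ [/= <-]].
by exists (shift (fst_half w)).
Qed.

Let measurable_fst A : measurable A -> measurable (@fst_half R @^-1` A).
Proof.
by move=> mA; rewrite -[X in measurable X]setTI; exact: measurable_fst_half.
Qed.

Let measurable_snd A : measurable A -> measurable (@snd_half R @^-1` A).
Proof.
by move=> mA; rewrite -[X in measurable X]setTI; exact: measurable_snd_half.
Qed.

Let measurable_pre m P (A : set (borel X)) : measurable A ->
  measurable (shifted m P @^-1` A).
Proof.
by move=> mA; rewrite -[X in measurable X]setTI; exact: measurable_shifted.
Qed.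

Let measurable_mixture P (A : set (borel X)) : measurable A ->
  measurable (mixture P @^-1` A : set (measurableTypeR R)).
Proof.
move=> mA; rewrite mixtureE; apply: bigcupT_measurable => m.
apply: measurableI; first by apply: measurable_fst; exact: measurable_shift.
by apply: measurable_snd; exact: measurable_pre.
Qed.

Let trivIset_shift : trivIset setT (fun m => [set v : R | shift v = m]).
Proof.
apply/trivIsetP => i j _ _ /eqP ij; rewrite -subset0 => v [vi vj].
exact: ij (etrans (esym vi) vj).
Qed.

Lemma mixture_law P : has_law (mixture P) P.
Proof.
split.
  move=> m01 A mA; apply: measurableI => //.
  by apply: cara_borel; exact: measurable_mixture.
move=> A mA; rewrite leb_unif; last exact: measurable_mixture.
rewrite mixtureE measure_semi_bigcup/=; last 3 first.
- move=> m; apply: measurableI; first by apply: measurable_fst; exact: measurable_shift.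
  by apply: measurable_snd; exact: measurable_pre.
- apply/trivIsetP => i j _ _ /eqP ij; rewrite -subset0 => w [[wi _] [wj _]].
  exact: ij (etrans (esym wi) wj).
- rewrite -mixtureE; exact: measurable_mixture.
rewrite -[RHS]mul1e -(@probability_setT _ _ _ (@unif R)).
have -> : [set: measurableTypeR R] = \bigcup_m [set v : R | shift v = m].
  by apply/seteqP; split => // v _; exists (shift v).
rewrite measure_semi_bigcup//=; last 2 first.
- by move=> m; exact: measurable_shift.
- by apply: bigcupT_measurable => m; exact: measurable_shift.
rewrite -[P A]fineK ?fin_num_measure// muleC -nneseriesZl//.
apply: eq_eseriesr => m _; rewrite unif_split ?shifted_law//.
- by rewrite fineK ?fin_num_measure// muleC.
- exact: measurable_shift.
- exact: measurable_pre.
Qed.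

Definition scale_dist P Q (j : int) : \bar R :=
  l1dist (mass e P (scale R j)) (mass e Q (scale R j)).

(** The shift is that of j, and the samples part between the consecutive radii
    scale j and scale (j + period) of the corresponding tree. *)
Let separated P Q (j : int) : set (measurableTypeR R) :=
  @fst_half R @^-1` [set v | shift v = `|(j %% period)%Z|%N] `&`
  @snd_half R @^-1` [set w |
    scale R j <= mdist (shifted `|(j %% period)%Z|%N P w)
                       (shifted `|(j %% period)%Z|%N Q w)
              < scale R (j + period%:Z)].

Let measurable_between m P Q (a b : R) : 0 < a -> 0 < b ->
  measurable [set w | a <= mdist (shifted m P w) (shifted m Q w) < b].
Proof.
move=> a0 b0.
have lt t : 0 < t -> measurable [set w | mdist (shifted m P w) (shifted m Q w) < t].
  move=> t0; rewrite -[X in measurable X]setTI.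
  by apply: (measurable_dist_lt hultra net) => //; exact: measurable_shifted.
rewrite (_ : mkset _ = [set w | mdist (shifted m P w) (shifted m Q w) < b] `\`
                       [set w | mdist (shifted m P w) (shifted m Q w) < a]).
  by apply: measurableD; exact: lt.
apply/seteqP; split => w /=.
  by move=> /andP[lo up]; split=> //; apply/negP; rewrite -leNgt.
by move=> [up /negP]; rewrite -leNgt => lo; rewrite lo up.
Qed.

Let measurable_separated P Q j : measurable (separated P Q j).
Proof.
apply: measurableI; first by apply: measurable_fst; exact: measurable_shift.
by apply: measurable_snd; apply: measurable_between; exact: scale_gt0.
Qed.

Let unif_separated P Q j :
  (unif (separated P Q j) <= (period%:R^-1)%:E *
     (scale_dist P Q j + scale_dist P Q (j + period%:Z)))%E.
Proof.
rewrite unif_split; last 2 first.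
- exact: measurable_shift.
- by apply: measurable_between; exact: scale_gt0.
rewrite unif_shift; last first.
  by rewrite -ltz_nat gez0_abs ?modz_ge0// ltz_pmod.
apply: lee_wpmul2l; first by rewrite lee_fin.
have := sample_split hultra net (@iid_level_stream R)
  (@radius_gt0 R `|(j %% period)%Z|%N) (@radius_homo R _) (@radius_small R _)
  (@radius_large R _) P Q (j %/ period)%Z.
by rewrite radius_scale radius_scaleS.
Qed.

(** A positive distance lies between two consecutive radii of the tree in use,
    and is smaller than the upper one. *)
Let dist_le_layers P Q w :
  ((mdist (mixture P w) (mixture Q w))%:E <=
   \sum_(n <oo) (scale R (zigzag n + period%:Z) *
                 \1_(separated P Q (zigzag n)) w)%R%:E)%E.
Proof.
have t0 n : (0 <= (scale R (zigzag n + period%:Z) *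
                 \1_(separated P Q (zigzag n)) w)%R%:E)%E.
  by rewrite lee_fin mulr_ge0// ltW// scale_gt0.
set c := mdist _ _; have [c0|c0] := leP c 0.
  by apply: (@le_trans _ _ 0%E); [rewrite lee_fin|exact: nneseries_ge0].
set m := shift (fst_half w); have [k ck] := radius_bracket m c0.
have [_ _ /(_ (m%:Z + period%:Z * k) Logic.I)[n _ nj]] := zigzag_bij.
set j := m%:Z + _ in nj.
have jm : (j %% period)%Z = m.
  by rewrite /j addrC mulrC modzMDl modz_small//= ltz_nat shift_lt.
have jk : (j %/ period)%Z = k.
  by rewrite /j addrC mulrC divzMDl// divz_small ?addr0//= ltz_nat shift_lt.
rewrite (@nneseriesD1 _ _ n)// nj; apply: (@le_trans _ _ (scale R (j + period%:Z))%:E).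
  by rewrite -radius_scaleS jm jk lee_fin; case/andP: ck => _ /ltW.
rewrite indicE mem_set ?mulr1 ?leeDl ?nneseries_ge0//.
split; first by rewrite /= jm.
by rewrite /= -radius_scaleS -radius_scale jm jk.
Qed.

(** The radius of index j is in use with probability 1 / period, and then
    contributes at most scale (j + period) times the sum of the two l1 distances
    of [sample_split].  A change of index in the terms that come from the second
    distance brings them back to index j. *)
Lemma mixture_cost P Q :
  (expected_cost (@mdist R X) (mixture P) (mixture Q) <=
   ((growth R ^+ period + 1) / period%:R)%R%:E *
   \sum_(n <oo) (scale R (zigzag n))%:E * scale_dist P Q (zigzag n))%E.
Proof.
have cs0 j : 0 <= scale R j := ltW (scale_gt0 R j).
have mI : measurable (`[0%R, 1%R] : set (caratheodory_type (wlength (@idfun R))^*%mu)).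
  by apply: cara_borel; exact: measurable_itv.
have mF n : measurable (separated P Q (zigzag n) :
    set (caratheodory_type (wlength (@idfun R))^*%mu)).
  exact: cara_borel.
have sd0 j : (0 <= scale_dist P Q j)%E by exact: nneseries_ge0.
pose h j := ((scale R j)%:E * scale_dist P Q j)%E.
have h0 j : (0 <= h j)%E by rewrite mule_ge0// lee_fin.
apply: (@le_trans _ _ (\sum_(n <oo) (period%:R^-1 * growth R ^+ period)%R%:E * h (zigzag n)
   + \sum_(n <oo) (period%:R^-1)%:E * h (zigzag n + period%:Z)%R)%E); last first.
  rewrite nneseriesZl// nneseriesZl//.
  rewrite (@zigzag_shift R h period%:Z)// -ge0_muleDl// ?lee_fin//.
    by rewrite -EFinD mulrDl mul1r [_ ^+ _ / _]mulrC.
  by rewrite mulr_ge0// exprn_ge0// ltW// growth_gt0.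
apply: (@le_trans _ _ (\sum_(n <oo) (scale R (zigzag n + period%:Z))%:E *
   leb R (separated P Q (zigzag n) `&` `[0%R, 1%R]))%E).
  apply: (@integral_le_layers _ (caratheodory_type (wlength (@idfun R))^*%mu)
    R (leb R) _ (fun n => scale R (zigzag n + period%:Z))
    (fun n => separated P Q (zigzag n)) _ mI _ mF).
  - by move=> n; exact: cs0.
  - by move=> w _; rewrite lee_fin mdist_ge0.
  - apply/measurable_EFinP; apply: (measurable_dist hultra net mI).
      exact: (mixture_law P).1.
    exact: (mixture_law Q).1.
  - by move=> w _; exact: dist_le_layers.
rewrite -nneseriesD; last 2 first.
- move=> n _ _; rewrite mule_ge0// lee_fin mulr_ge0// exprn_ge0//.
  by rewrite ltW// growth_gt0.
- by move=> n _ _; rewrite mule_ge0// lee_fin.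
apply: lee_nneseries => n _; first by rewrite mule_ge0// lee_fin.
rewrite setIC leb_unif//.
set j := zigzag n.
apply: (@le_trans _ _ ((scale R (j + period%:Z))%:E * ((period%:R^-1)%:E *
     (scale_dist P Q j + scale_dist P Q (j + period%:Z)%R)))%E).
  by rewrite lee_wpmul2l ?lee_fin//; exact: unif_separated.
rewrite /h muleDr ?ge0_adde_def ?inE// muleDr ?ge0_adde_def ?inE ?mule_ge0//.
rewrite !muleA -!EFinM; apply: leeD.
  rewrite scaleD; apply: lee_wpmul2r => //; rewrite lee_fin /scale -exprnP.
  by rewrite le_eqVlt; apply/orP; left; apply/eqP; ring.
by rewrite mulrC.
Qed.

End mixture.

(** * The cost of an arbitrary coupling, and the ratio *)

Section lower_bound.
Variables (R : realType) (X : completeMetricType R) (e : nat -> X).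
Hypothesis hultra : ultrametric (@mdist R X).
Hypothesis net : forall x t, 0 < t -> exists n, mdist (e n) x < t.
Notation caraR := (caratheodory_type (wlength (@idfun R))^*%mu).
Variables (P Q : probability (borel X) R) (Y Z : caraR -> X).
Hypotheses (YP : has_law Y P) (ZQ : has_law Z Q).

Let I01 : set caraR := `[0%R, 1%R].

Let mI : measurable I01.
Proof. by apply: cara_borel; exact: measurable_itv. Qed.

Let apart (j : int) : set caraR :=
  I01 `&` [set w | scale R j <= mdist (Y w) (Z w)].

Let measurable_apart j : measurable (apart j).
Proof.
rewrite (_ : apart j = I01 `\` (I01 `&` [set w | mdist (Y w) (Z w) < scale R j])).
  apply: measurableD => //; apply: (measurable_dist_lt hultra net) => //.
  - exact: scale_gt0.
  - exact: YP.1.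
  - exact: ZQ.1.
apply/seteqP; split => w [Iw h]; split => //=.
  by move=> [_]; rewrite ltNge h.
by rewrite leNgt; apply/negP => lt; apply: h.
Qed.

Let apart_ge (U V : caraR -> X) (j : int) :
  measurable_fun I01 (U : caraR -> borel X) ->
  measurable_fun I01 (V : caraR -> borel X) ->
  (forall w, mdist (U w) (V w) = mdist (Y w) (Z w)) ->
  (\sum_(n <oo) leb R ((I01 `&` U @^-1` block e (scale R j) n) `\`
                      (I01 `&` V @^-1` block e (scale R j) n)) <=
   leb R (apart j))%E.
Proof.
move=> mU mV UV; have s0 := scale_gt0 R j.
have mpre (f : caraR -> X) n : measurable_fun I01 (f : caraR -> borel X) ->
    measurable (I01 `&` f @^-1` block e (scale R j) n).
  by move=> mf; apply: mf => //; exact: (measurable_block hultra net).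
have mD n : measurable ((I01 `&` U @^-1` block e (scale R j) n) `\`
                      (I01 `&` V @^-1` block e (scale R j) n)).
  by apply: measurableD; exact: mpre.
rewrite -measure_semi_bigcup//.
- apply: le_measure; rewrite ?inE//; first exact: bigcupT_measurable.
  move=> w [n _ [[Iw Uw] Vw]]; split=> //=; rewrite -UV leNgt; apply/negP.
  move=> /(label_eq hultra net _ _ s0) lab; apply: Vw; split=> //.
  by rewrite /preimage /block /= -lab.
- apply/trivIsetP => m n _ _ /eqP mn; rewrite -subset0 => w [[[_ a] _] [[_ b] _]].
  exact: mn (etrans (esym a) b).
- exact: bigcupT_measurable.
Qed.

(** When one variable is in a block of radius scale j and the other is not,
    they are apart.  This can happen in two ways, hence the factor 2. *)
Let scale_dist_le j : (scale_dist e P Q j <= 2%:E * leb R (apart j))%E.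
Proof.
have s0 := scale_gt0 R j.
pose A n := I01 `&` Y @^-1` block e (scale R j) n.
pose B n := I01 `&` Z @^-1` block e (scale R j) n.
have mA n : measurable (A n).
  by apply: YP.1 => //; exact: (measurable_block hultra net).
have mB n : measurable (B n).
  by apply: ZQ.1 => //; exact: (measurable_block hultra net).
have PA n : P (block e (scale R j) n) = leb R (A n).
  by rewrite YP.2//; exact: (measurable_block hultra net).
have QB n : Q (block e (scale R j) n) = leb R (B n).
  by rewrite ZQ.2//; exact: (measurable_block hultra net).
have fin (C : set caraR) : measurable C -> C `<=` I01 -> leb R C \is a fin_num.
  move=> mC CI; rewrite ge0_fin_numE//.
  apply: (@le_lt_trans _ _ (leb R I01)); first by apply: le_measure; rewrite ?inE.
  by rewrite -(setIT I01) leb_unif// probability_setT ltry.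
apply: (@le_trans _ _ (\sum_(n <oo) (leb R (A n `\` B n) + leb R (B n `\` A n)))%E).
  apply: lee_nneseries => // n _; rewrite /mass PA QB.
  have decomp (C C' : set caraR) : measurable C -> measurable C' ->
      leb R C = (leb R (C `\` C') + leb R (C `&` C'))%E.
    by move=> mC mC'; rewrite -measureDI.
  rewrite (decomp (A n) (B n))// (decomp (B n) (A n))// [B n `&` _]setIC.
  have fAB : leb R (A n `&` B n) \is a fin_num.
    by apply: fin; [exact: measurableI|move=> w [[]]].
  have fA : leb R (A n `\` B n) \is a fin_num.
    by apply: fin; [exact: measurableD|move=> w [[]]].
  have fB : leb R (B n `\` A n) \is a fin_num.
    by apply: fin; [exact: measurableD|move=> w [[]]].
  rewrite -(fineK fAB) -(fineK fA) -(fineK fB) -!EFinD lee_fin /=.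
  set a := fine _; set b := fine _; set c := fine _.
  have b0 : 0 <= b by exact: fine_ge0.
  have a0 : 0 <= a by exact: fine_ge0.
  have c0 : 0 <= c by exact: fine_ge0.
  by rewrite ler_norml; apply/andP; split; lra.
rewrite nneseriesD//.
have -> : (2%:E * leb R (apart j) = leb R (apart j) + leb R (apart j))%E.
  by rewrite -mule2n muleC -mule_natl muleC.
apply: leeD.
  by apply: apart_ge; [exact: YP.1|exact: ZQ.1|].
apply: apart_ge; [exact: ZQ.1|exact: YP.1|].
by move=> w; rewrite metric_sym.
Qed.

Let step_ge0 j : 0 <= scale R j - scale R (j - 1).
Proof.
by rewrite subr_ge0 -[X in _ <= scale R X](subrK 1); exact: (scale_homo R _ 1).
Qed.

(** The increments of the radii up to the distance telescope. *)
Let layers_le w : I01 w ->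
  (\sum_(n <oo) ((scale R (zigzag n) - scale R (zigzag n - 1)) *
                 \1_(apart (zigzag n)) w)%R%:E <= (mdist (Y w) (Z w))%:E)%E.
Proof.
move=> Iw; set c := mdist _ _.
have t0 n : (0 <= ((scale R (zigzag n) - scale R (zigzag n - 1)) *
                 \1_(apart (zigzag n)) w)%R%:E)%E.
  by rewrite lee_fin mulr_ge0.
apply: lime_le; first exact: is_cvg_nneseries.
apply: nearW => N.
apply: (@le_trans _ _ (\sum_(0 <= n < N.*2)
    ((scale R (zigzag n) - scale R (zigzag n - 1)) *
     \1_(apart (zigzag n)) w)%R%:E)%E).
  rewrite [leRHS](@big_cat_nat _ _ _ N)//=; last by rewrite -addnn leq_addr.
  by rewrite leeDl// sume_ge0.
rewrite big_mkord sumEFin lee_fin.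
(* capping the radii at the distance makes the sum telescope *)
pose g j := Num.min c (scale R j).
have c0 : 0 <= c by exact: mdist_ge0.
apply: (@le_trans _ _ (\sum_(n < N.*2) (g (zigzag n) - g (zigzag n - 1)))).
  apply: ler_sum => n _; set j := zigzag n; have := step_ge0 j => sj.
  rewrite indicE /g; have [cj|cj] := leP (scale R j) c.
    rewrite mem_set ?mulr1; last by split.
    by rewrite (min_idPr _)//; move: sj; lra.
  rewrite memNset ?mulr0; last by move=> [_] /=; rewrite leNgt cj.
  by rewrite subr_ge0 ge_min lexx.
rewrite zigzag_telescope.
have : g (N%:Z - 1) <= c by rewrite ge_min lexx.
have : 0 <= g (- N%:Z - 1) by rewrite le_min c0 ltW// scale_gt0.
lra.
Qed.

Lemma cost_ge :
  (((1 - (growth R)^-1) / 2%:R)%R%:E *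
   \sum_(n <oo) (scale R (zigzag n))%:E * scale_dist e P Q (zigzag n) <=
   expected_cost (@mdist R X) Y Z)%E.
Proof.
have k0 : 0 <= (1 - (growth R)^-1) / 2%:R :> R.
  by rewrite divr_ge0// subr_ge0 invf_le1 ?growth_gt0// ltW// growth_gt1.
have sd0 j : (0 <= scale_dist e P Q j)%E by exact: nneseries_ge0.
rewrite -nneseriesZl; last first.
  by move=> n _; rewrite mule_ge0// lee_fin ltW// scale_gt0.
apply: (@le_trans _ _ (\sum_(n <oo) (scale R (zigzag n) - scale R (zigzag n - 1))%:E *
   leb R (apart (zigzag n) `&` I01))%E).
  apply: lee_nneseries => n _.
    by rewrite !mule_ge0// lee_fin ltW// scale_gt0.
  rewrite (_ : apart _ `&` I01 = apart (zigzag n)); last first.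
    by apply: setIidl => w [].
  set j := zigzag n.
  have -> : scale R j - scale R (j - 1) = scale R j * (1 - (growth R)^-1).
    by rewrite scaleD mulrBr mulr1 {3}/scale exprN1.
  apply: (@le_trans _ _ (((1 - (growth R)^-1) / 2%:R)%R%:E *
      ((scale R j)%:E * (2%:E * leb R (apart j))))%E).
    apply: lee_wpmul2l; first by rewrite lee_fin.
    by apply: lee_wpmul2l; [rewrite lee_fin ltW// scale_gt0|exact: scale_dist_le].
  rewrite !muleA -!EFinM.
  by rewrite (_ : _ * _ * _ = scale R j * (1 - (growth R)^-1))// mulrAC divfK// mulrC.
apply: (@layers_le_integral _ caraR R (leb R) _
  (fun n => scale R (zigzag n) - scale R (zigzag n - 1))
  (fun n => apart (zigzag n)) _ mI).
- by move=> n; exact: step_ge0.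
- by move=> n; exact: measurable_apart.
- apply/measurable_EFinP; apply: (measurable_dist hultra net mI).
    exact: YP.1.
  exact: ZQ.1.
- exact: layers_le.
Qed.

End lower_bound.

Theorem theorem17 (R : realType) (X : completeMetricType R)
    (hsep : separable X) (hultra : ultrametric (@mdist R X)) :
  (optimal_ratio (@mdist R X) (fun P : probability (borel X) R => P)
     < (756%:R / 100%:R : R)%:E)%E.
Proof.
have [e net] := separable_net hsep.
pose lo : R := (1 - (growth R)^-1) / 2%:R.
pose up : R := (growth R ^+ period + 1) / period%:R.
have r0 := growth_gt0 R.
have lo0 : 0 < lo by rewrite divr_gt0// subr_gt0 invf_lt1// growth_gt1.
have up0 : 0 < up by rewrite divr_gt0// addr_gt0// exprn_gt0.
apply: (@le_lt_trans _ _ (up / lo)%:E).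
  apply: le_trans; first apply: ereal_inf_lbound.
    by exists (mixture e) => // P; exact: mixture_law.
  apply: ereal_inf_lbound; exists (up / lo) => //; split.
    rewrite ler_pdivlMr// mul1r /lo /up /growth /period; lra.
  move=> P Q; apply: (le_trans (mixture_cost hultra net P Q)).
  set A := (\sum_(n <oo) _)%E.
  have A0 : (0 <= A)%E.
    apply: nneseries_ge0 => n _ _; rewrite mule_ge0//; last exact: nneseries_ge0.
    by rewrite lee_fin ltW// scale_gt0.
  have loA : (lo%:E * A <= optimal_cost (@mdist R X) P Q)%E.
    apply: le_ereal_inf_tmp => _ [Y [Z [YP ZQ ->]]].
    exact: (cost_ge hultra net YP ZQ).
  have -> : (up%:E * A = (up / lo)%:E * (lo%:E * A))%E.
    by rewrite muleA -EFinM divfK// gt_eqF.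
  by apply: lee_wpmul2l => //; rewrite lee_fin ltW// divr_gt0.
rewrite lte_fin ltr_pdivrMr// /lo /up /growth /period.
lra.
Qed.
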